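(* Let $n\ge1$, let $1<q<\infty$ be fixed and let $v\in\mathbb{S}^n$. Then $$c_{q,n+1}\,|P_{v^\perp}(B_q^{n+1}\cap\mathbb{R}^{n+1}_+)|_n\le|P_{v^\perp}B_q^{n+1}|_n\le2^n\,|P_{v^\perp}(B_q^{n+1}\cap\mathbb{R}^{n+1}_+)|_n ,$$ where $$c_{q,n+1}:=\frac{2^n\,|P_{\theta^\perp}B_q^{n+1}|_n}{\sqrt{n+1}\,|B_q^n|},\qquad\theta=\left(\tfrac1{\sqrt{n+1}},\dots,\tfrac1{\sqrt{n+1}}\right).$$ Equality holds in the right inequality if and only if either $v$ has exactly one nonzero component, or $v$ has exactly two nonzero components and they have different signs. The left inequality is sharp, with equality attained at $v=\theta$.
   Context: $B_q^d=\{x\in\mathbb{R}^d:\sum_i|x_i|^q\le1\}$, $\mathbb{R}^d_+=\{x\in\mathbb{R}^d:x_i\ge0\ \forall i\}$, $\mathbb{S}^n$ is the Euclidean unit sphere of $\mathbb{R}^{n+1}$, $v^\perp$ is the hyperplane of $\mathbb{R}^{n+1}$ orthogonal to $v$, $P_E$ is orthogonal projection onto $E$, and $|\cdot|_n$ is $n$-dimensional Lebesgue measure ($|B_q^n|$ is the $n$-dimensional volume of $B_q^n$). *)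

(* Defs.v *)
From HB Require Import structures.
From mathcomp Require Import all_boot all_order all_algebra.
From mathcomp Require Import all_classical all_reals all_analysis.
From mathcomp Require Import ring.

Set Implicit Arguments.
Unset Strict Implicit.
Unset Printing Implicit Defensive.

Import Order.TTheory GRing.Theory Num.Theory.
Import numFieldNormedType.Exports.

Local Open Scope classical_set_scope.
Local Open Scope ring_scope.

Section lebesgue_measure_Rn.
Variable R : realType.
Local Notation tupleR n := (n.-tuple (measurableTypeR R)).

Definition cons_pair n (p : measurableTypeR R * tupleR n) : tupleR n.+1 :=
  [tuple of p.1 :: p.2].

(* The n-fold product of the Lebesgue measure on the line, on the Borel        *)
(* sigma-algebra of n.-tuple R.                                                *)
Fixpoint lebesgue_tuple n : set (tupleR n) -> \bar R :=
  match n with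
  | 0 => \d_[tuple]
  | k.+1 =>
      pushforward (lebesgue_measure \x lebesgue_tuple (n := k))%E (@cons_pair k)
  end.

Lemma measurable_cons_pair n : measurable_fun [set: _] (@cons_pair n).
Proof. exact: measurable_cons. Qed.

Lemma pushforward_cons_sigma_finite n
    (m : {sigma_finite_measure set (tupleR n) -> \bar R}) :
  sigma_finite setT (pushforward (lebesgue_measure \x m)%E (@cons_pair n)).
Proof.
have /sigma_finiteP[F [TF ndF Foo]] := sigma_finiteT (@lebesgue_measure R).
have /sigma_finiteP[G [TG ndG Goo]] := sigma_finiteT m.
pose g (t : tupleR n.+1) := (thead t, [tuple of behead t]).
have consK : cancel (@cons_pair n) g.
  by case=> x t; rewrite /g /cons_pair theadE; congr pair; apply: val_inj.
have mg : measurable_fun setT g.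
  apply: measurable_fun_pair; first exact: measurable_tnth.
  apply/measurable_fun_tnthP => i.
  rewrite (_ : _ \o _ = (@tnth _ (measurableTypeR R)) ^~ (lift ord0 i)).
    exact: measurable_tnth.
  apply/funext => t /=; rewrite !(tnth_nth (thead t)) /= nth_behead.
  by rewrite /bump leq0n.
exists (fun k => g @^-1` (F k `*` G k)).
  rewrite -preimage_bigcup (_ : \bigcup_k _ = setT) ?preimage_setT//.
  apply/seteqP; split => // -[x y] _.
  have [i _ Fx] : (\bigcup_k F k) x by rewrite -TF.
  have [j _ Gy] : (\bigcup_k G k) y by rewrite -TG.
  exists (maxn i j) => //; split => /=.
    by move: x Fx; exact/subsetPset/ndF/leq_maxl.
  by move: y Gy; exact/subsetPset/ndG/leq_maxr.
move=> k; have [mF Fk] := Foo k; have [mG Gk] := Goo k; split.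
  by rewrite -[X in measurable X]setTI; apply: mg => //; exact: measurableX.
rewrite /pushforward -comp_preimage (_ : g \o _ = id); last exact/funext.
rewrite preimage_id product_measure1E//.
by rewrite lte_mul_pinfty// ge0_fin_numE.
Qed.

Section lebesgue_cons.
Variables (n : nat) (m : {sigma_finite_measure set (tupleR n) -> \bar R}).

Let lebesgue_cons := pushforward (lebesgue_measure \x m)%E (@cons_pair n).

Let lebesgue_cons0 : lebesgue_cons set0 = 0%E.
Proof. by apply: measure0; exact: measurable_cons_pair. Qed.

Let lebesgue_cons_ge0 A : (0 <= lebesgue_cons A)%E.
Proof. by apply: measure_ge0; exact: measurable_cons_pair. Qed.

Let lebesgue_cons_sigma_additive : semi_sigma_additive lebesgue_cons.
Proof. by apply: measure_semi_sigma_additive; exact: measurable_cons_pair. Qed.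

HB.instance Definition _ := isMeasure.Build _ _ _ lebesgue_cons
  lebesgue_cons0 lebesgue_cons_ge0 lebesgue_cons_sigma_additive.

HB.instance Definition _ := @Measure_isSigmaFinite.Build _ _ _ lebesgue_cons
  (pushforward_cons_sigma_finite m).

Lemma lebesgue_consE : exists mu : {sigma_finite_measure set _ -> \bar R},
  pushforward (lebesgue_measure \x m)%E (@cons_pair n) = mu.
Proof. by exists lebesgue_cons. Qed.

End lebesgue_cons.

Lemma lebesgue_tuple_bundle n :
  exists mu : {sigma_finite_measure set (tupleR n) -> \bar R},
    @lebesgue_tuple n = mu.
Proof.
elim: n => [|n [m mE]]; first by exists \d_[tuple].
by rewrite /= mE; exact: lebesgue_consE.
Qed.

Section lebesgue_tuple_measure.
Variable n : nat.

Let lebesgue_tuple0 : @lebesgue_tuple n set0 = 0%E.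
Proof. by have [m ->] := lebesgue_tuple_bundle n. Qed.

Let lebesgue_tuple_ge0 A : (0 <= @lebesgue_tuple n A)%E.
Proof. by have [m ->] := lebesgue_tuple_bundle n. Qed.

Let lebesgue_tuple_sigma_additive : semi_sigma_additive (@lebesgue_tuple n).
Proof.
by have [m ->] := lebesgue_tuple_bundle n; exact: measure_semi_sigma_additive.
Qed.

HB.instance Definition _ := isMeasure.Build _ _ _ (@lebesgue_tuple n)
  lebesgue_tuple0 lebesgue_tuple_ge0 lebesgue_tuple_sigma_additive.

Let lebesgue_tuple_sigma_finite : sigma_finite setT (@lebesgue_tuple n).
Proof. by have [m ->] := lebesgue_tuple_bundle n; exact: sigma_finiteT. Qed.

HB.instance Definition _ := @Measure_isSigmaFinite.Build _ _ _
  (@lebesgue_tuple n) lebesgue_tuple_sigma_finite.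

End lebesgue_tuple_measure.

Lemma lebesgue_tuple_box n (A : 'I_n -> set (measurableTypeR R)) :
  (forall i, measurable (A i)) ->
  lebesgue_tuple [set t : tupleR n | forall i, A i (tnth t i)] =
  (\prod_(i < n) lebesgue_measure (A i))%E.
Proof.
elim: n A => [|n ih] A mA.
  rewrite big_ord0 /= diracE mem_set //; by case.
rewrite big_ord_recl -ih //= /pushforward -product_measure1E//; last first.
  rewrite (_ : [set _ | _] =
    \bigcap_(i in [set: 'I_n]) (@tnth _ _)^~ i @^-1` A (lift ord0 i)).
    apply: fin_bigcap_measurable => // i _.
    by rewrite -[X in measurable X]setTI; exact: measurable_tnth.
  by apply/seteqP; split => [t tA i _|t tA i]; [exact: tA|exact: (tA i)].
congr product_measure1; apply/seteqP; split => -[x t] /=.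
  move=> tA; split; first exact: (tA ord0).
  by move=> i; have := tA (lift ord0 i); rewrite tnthS.
move=> [xA tA] i; case: (unliftP ord0 i) => [j ->|->] //.
by rewrite tnthS; exact: tA.
Qed.

End lebesgue_measure_Rn.

Section hyperplanes.
Variable R : realType.

(* Euclidean inner product; the library norm on matrices is the sup norm.      *)
Definition dotr d (x y : 'rV[R]_d) : R := \sum_(i < d) x 0 i * y 0 i.

(* Orthogonal projection onto the hyperplane orthogonal to v.                  *)
Definition perp_proj d (v x : 'rV[R]_d) : 'rV[R]_d :=
  x - (dotr x v / dotr v v) *: v.

(* The rows of U form an orthonormal basis of the hyperplane orthogonal to v.  *)
Definition perp_basis n (v : 'rV[R]_n.+1) (U : 'M[R]_(n, n.+1)) : Prop :=
  U *m U^T = 1%:M /\ U *m v^T = 0.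

Lemma mulmx_dotr d (x y : 'rV[R]_d) : x *m y^T = (dotr x y)%:M.
Proof.
apply/rowP => i; rewrite !mxE (ord1 i) eqxx mulr1n.
by apply: eq_bigr => j _; rewrite mxE.
Qed.

Lemma dotr_eq0 d (x : 'rV[R]_d) : dotr x x = 0 -> x = 0.
Proof.
move=> /eqP; rewrite psumr_eq0; last by move=> i _; rewrite -expr2 sqr_ge0.
move=> /allP x0; apply/rowP => i; rewrite mxE; apply/eqP.
by have := x0 i (mem_index_enum i); rewrite mulf_eq0 orbb.
Qed.

(* The last n rows of the Householder reflection exchanging v and the first    *)
(* coordinate vector.                                                          *)
Lemma perp_basis_exists n (v : 'rV[R]_n.+1) :
  dotr v v = 1 -> exists U, perp_basis v U.
Proof.
move=> v1.
pose e : 'rV[R]_n.+1 := delta_mx 0 0.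
have [w wE] : {w | w = v - e} by exists (v - e).
pose s := dotr w w.
pose c := 2 / s.
have sE : s = 2 - 2 * v 0 0.
  have ex x : dotr e x = x 0 0.
    rewrite /dotr (bigD1 ord0) //= big1 ?addr0; last first.
      by move=> i i0; rewrite mxE (negbTE i0) andbF mul0r.
    by rewrite mxE !eqxx mul1r.
  have xe x : dotr x e = x 0 0.
    by rewrite -ex /dotr; apply: eq_bigr => i _; rewrite mulrC.
  have -> : s = dotr v v - dotr v e - dotr e v + dotr e e.
    rewrite /s wE /dotr -!sumrB -big_split /=; apply: eq_bigr => i _.
    by rewrite !mxE; ring.
  by rewrite ex !xe v1 mxE !eqxx /=; ring.
pose H : 'M[R]_n.+1 := 1%:M - c *: (w^T *m w).
have HT : H^T = H by rewrite /H linearB linearZ /= trmx1 trmx_mul trmxK.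
have HH : H *m H^T = 1%:M.
  have WW : (w^T *m w) *m (w^T *m w) = s *: (w^T *m w).
    by rewrite mulmxA -(mulmxA _ w) mulmx_dotr -/s mul_mx_scalar scalemxAl.
  rewrite HT /H mulmxBl mul1mx mulmxBr mulmx1 -scalemxAr -scalemxAl WW !scalerA.
  have [s0|s0] := eqVneq s 0.
    by rewrite /c s0 invr0 !mulr0 !scale0r !subr0.
  rewrite (_ : c * c * s = c + c); last by rewrite /c; field.
  by rewrite scalerDl; set a := c *: _; rewrite opprB addrK subrK.
have eH : e *m H = v.
  rewrite /H mulmxBr mulmx1 -scalemxAr mulmxA mulmx_dotr mul_scalar_mx scalerA.
  have -> : dotr e w = v 0 0 - 1.
    rewrite wE /dotr (bigD1 ord0) //= big1 ?addr0; last first.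
      by move=> i i0; rewrite mxE (negbTE i0) andbF mul0r.
    by rewrite !mxE !eqxx mul1r.
  have [s0|s0] := eqVneq s 0.
    have /eqP := dotr_eq0 s0; rewrite wE subr_eq0 => /eqP ->.
    by rewrite /c s0 invr0 mulr0 mul0r scale0r subr0.
  have -> : c * (v 0 0 - 1) = -1.
    by move: s0; rewrite /c sE => s0; field.
  by rewrite scaleN1r opprK wE addrC subrK.
have HrT : rowsub (lift ord0) H *m H^T = rowsub (lift ord0) 1%:M.
  by rewrite -HH mul_rowsub_mx.
exists (rowsub (lift ord0) H); split; last first.
  rewrite -eH trmx_mul mulmxA HrT mul_rowsub_mx mul1mx.
  by apply/colP => i; rewrite !mxE andbF.
rewrite -[X in X^T]/(mxsub _ id H) trmx_mxsub mulmx_colsub HrT.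
by apply/matrixP => i j; rewrite !mxE (inj_eq (@lift_inj _ ord0)).
Qed.

(* Some orthonormal basis of the hyperplane orthogonal to v, for v <> 0; the   *)
(* volume computed from it does not depend on the choice, as Lebesgue measure  *)
(* is invariant under orthogonal maps.                                         *)
Definition perp_frame n (v : 'rV[R]_n.+1) : 'M[R]_(n, n.+1) :=
  xget 0 [set U | perp_basis v U].

Lemma perp_frameP n (v : 'rV[R]_n.+1) :
  dotr v v = 1 -> perp_basis v (perp_frame v).
Proof. by move=> /perp_basis_exists[U vU]; exact: xgetI vU. Qed.

Definition row_of_tuple n (t : n.-tuple R) : 'rV[R]_n := \row_i tnth t i.

Definition vol n (A : set 'rV[R]_n) : \bar R :=
  lebesgue_tuple (@row_of_tuple n @^-1` A).

(* n-dimensional Lebesgue measure of a subset of the hyperplane orthogonal to  *)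
(* v, identified with R^n through an orthonormal basis.                        *)
Definition perp_vol n (v : 'rV[R]_n.+1) (A : set 'rV[R]_n.+1) : \bar R :=
  vol [set y : 'rV[R]_n | A (y *m perp_frame v)].

Definition theta_vec n : 'rV[R]_n.+1 := const_mx (Num.sqrt n.+1%:R)^-1.

End hyperplanes.

Definition lq_ball (R : realType) (q : R) (d : nat) : set 'rV[R]_d :=
  [set x | \sum_(i < d) `|x 0 i| `^ q <= 1].
Arguments lq_ball {R} q d _.

Definition nonneg_orthant (R : realType) (d : nat) : set 'rV[R]_d :=
  [set x | forall i, 0 <= x 0 i].
Arguments nonneg_orthant {R} d _.

Arguments theta_vec {R} n.

(* The measured sets are compact, hence of finite measure: fine only turns     *)
(* their extended real volume into a real.                                     *)
Definition c_const (R : realType) (q : R) (n : nat) : R :=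
  2 ^+ n * fine (perp_vol (theta_vec n)
                   (perp_proj (theta_vec n) @` lq_ball q n.+1)) /
  (Num.sqrt n.+1%:R * fine (vol (lq_ball q n))).

(* Main.v *)
Require Import Defs.
From HB Require Import structures.
From mathcomp Require Import all_boot all_order all_algebra.
From mathcomp Require Import fingroup perm.
From mathcomp Require Import all_classical all_reals all_analysis.
From mathcomp Require Import measurable_realfun.
From mathcomp Require Import ring lra.

(** Let d = n + 1.  For tau > 0 replace |x|^q by the function equal to x^q for
    x >= 0 and to (|x| / tau)^q for x < 0, let Phi be the sum of these functions
    over the coordinates and B_tau = {Phi <= 1}.  Then B_1 is the l_q ball, and
    as tau decreases to 0 the sets B_tau decrease to its nonnegative part, so
    both projections of the theorem can be treated at once.

    Volumes of projections as fluxes.  Along a line parallel to v the function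
    Phi is strictly convex and continuously differentiable, so by the
    fundamental theorem of calculus the integral of |dPhi/ds| over the part of
    the line in {Phi <= 1} is twice the drop from 1 to the minimum of Phi
    ([integral_convex_line], [integral_line]).  Integrating over the lines, in
    an orthonormal frame adapted to v ([ge0_integral_frame], which rests on the
    invariance of Lebesgue measure under orthogonal maps), and using the layer
    cake formula and the homogeneity of Phi, one finds that the integral of
    |<v, grad Phi>| over B_tau is the volume of the projection of B_tau along v
    times a constant that depends neither on v nor on tau ([shadow_formula]).
    This replaces Cauchy's formula by an argument without surface measure.

    Reduction to one orthant.  Splitting the integral into orthants and
    rescaling each of them to the positive one gives
    sum_I tau^|I| J(v_I) ([flux_orthants]), where J(w) is the integral of
    |sum_i w_i x_i^(q-1)| over the positive part of the ball and v_I is v with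
    the entries in I multiplied by - 1 / tau.  Hence, up to one common factor:
    - the projection of the ball has volume N(v), the sum of J over all the sign
      changes of v ([projection_vol]);
    - letting tau tend to 0, where only the terms with |I| <= 1 survive, the
      projection of the nonnegative part has volume J(v) + sum_i |v_i| J(e_i)
      ([flux_cvg], [orthant_projection_vol]); the last sum is the contribution
      of the facets;
    - the ball of dimension n has volume 2^d J(e_0) ([ball_vol]).

    Right inequality.  J integrates |<w, a>| over vectors a >= 0, so it is enough
    to show, with z_i = v_i a_i, that twice the sum of |sum_i +-z_i| over all
    signs is at most 2^d (|sum_i z_i| + sum_i |z_i|).  Pair the patterns that
    differ exactly at the negative z_i and use
    |a + b| + |a - b| = 2 max(|a|, |b|) ([rademacher_le]).  Equality holds for
    every a if no two entries of v have the same strict sign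
    ([rademacher_eq]); if two do, the inequality is strict near the points where
    the corresponding z_i and z_j dominate ([rademacher_lt], [flux_sum1_lt]).

    Left inequality.  On the one hand J(v) <= sum_i |v_i| J(e_i), where all the
    J(e_i) are equal, so the projection of the nonnegative part is at most
    2 |v|_1 J(e_0), with equality for nonnegative v.  On the other hand N is a
    norm invariant under permutations and changes of signs, so averaging v over
    cyclic shifts gives N(v) >= (|v|_1 / d) N(1, ..., 1) ([flux_sum1_ones]), with
    equality at theta.  Together these are the left inequality and its equality
    case. *)

Set Implicit Arguments.
Unset Strict Implicit.
Unset Printing Implicit Defensive.

Import Order.TTheory GRing.Theory Num.Theory.
Import numFieldNormedType.Exports.

Local Open Scope classical_set_scope.
Local Open Scope ring_scope.

Section projections.
Context {R : realType}.
Notation RM := (measurableTypeR R).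
Notation mu := (@lebesgue_measure R).
Notation tupleR n := (n.-tuple (measurableTypeR R)).
Notation lam n := (@lebesgue_tuple R n).
Notation rv := (@row_of_tuple R _).

(** * Lebesgue measure under translations and linear maps *)

Lemma measurable_fun_preimage d1 d2 (T1 : measurableType d1) (T2 : measurableType d2)
  (f : T1 -> T2) A : measurable_fun setT f -> measurable A ->
  measurable (f @^-1` A).
Proof. by move=> mf mA; rewrite -[X in measurable X]setTI; exact: mf. Qed.

Lemma pushforward_measure d1 d2 (T1 : measurableType d1) (T2 : measurableType d2)
    (m : {measure set T1 -> \bar R}) (f : T1 -> T2) : measurable_fun setT f ->
  exists nu : {measure set T2 -> \bar R}, pushforward m f = nu.
Proof.
move=> mf.
by exists (measure_function_pushforward__canonical__measure_function_Measure m mf).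
Qed.

(** The translate of Lebesgue measure is a measure that agrees with it on
    intervals, hence everywhere. *)
Lemma lebesgue_measure_shift (a : R) (A : set RM) : measurable A ->
  mu ((fun x : RM => a + x : RM) @^-1` A) = mu A.
Proof.
move=> mA; have mf : measurable_fun [set: RM]
    (fun x : RM => a + x : RM) by exact: measurable_funD.
have [nu nuE] := pushforward_measure mu mf.
rewrite -[LHS]/(pushforward mu _ A) nuE -(@lebesgue_measure_unique R nu)// =>
  _ [[x y]] _ <-.
rewrite -nuE /pushforward.
rewrite (_ : _ @^-1` _ = `]x - a, y - a]%classic); last first.
  by apply/seteqP; split => z /=; rewrite !in_itv/= => /andP[? ?]; apply/andP; split;
    lra.
rewrite lebesgue_measure_itv [RHS](lebesgue_measure_itv `]x - a, y - a])/=.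
rewrite !lte_fin ltrD2r; case: ifP => // _.
by rewrite -!EFinB; congr EFin; ring.
Qed.

Lemma ge0_integral_scale_measure d0 (T : measurableType d0)
    (m : {measure set T -> \bar R}) (phi : T -> T) (k : {nonneg R})
    (f : T -> \bar R) :
  measurable_fun setT phi ->
  (forall A, measurable A -> m (phi @^-1` A) = (k%:num%:E * m A)%E) ->
  measurable_fun setT f -> (forall x, (0 <= f x)%E) ->
  (\int[m]_x f (phi x) = k%:num%:E * \int[m]_x f x)%E.
Proof.
move=> mphi mk mf f0.
have := ge0_integral_pushforward mphi m measurableT mf (fun y _ => f0 y).
rewrite preimage_setT => <-; rewrite -ge0_integral_mscale//.
have [nu nuE] := pushforward_measure m mphi.
have {}mk A : measurable A -> nu A = mscale k m A by rewrite -nuE; exact: mk.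
by rewrite nuE; apply: eq_measure_integral => A mA _; exact: mk.
Qed.

Lemma ge0_integral_lebesgue_shift (a : R) (f : RM -> \bar R) :
  measurable_fun setT f -> (forall x, (0 <= f x)%E) ->
  (\int[mu]_x f (a + x : RM)%R = \int[mu]_x f x)%E.
Proof.
move=> mf f0.
have ms : measurable_fun [set: RM] (fun x : RM => a + x : RM).
  exact: measurable_funD.
rewrite (ge0_integral_scale_measure (k := 1%:nng) ms _ mf f0) ?mul1e//.
by move=> A mA; rewrite mul1e; exact: lebesgue_measure_shift.
Qed.

Lemma lebesgue_tuple_cons n (A : set (tupleR n.+1)) : measurable A ->
  lam n.+1 A = (\int[mu]_x lam n ((fun t => cons_pair (x, t)) @^-1` A))%E.
Proof.
move=> mA; rewrite /= /pushforward/= /product_measure1; apply: eq_integral => x _ /=.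
by congr lebesgue_tuple; rewrite xsectionE.
Qed.

Lemma ge0_integral_cons n (f : tupleR n.+1 -> \bar R) :
  measurable_fun setT f -> (forall x, (0 <= f x)%E) ->
  (\int[lam n.+1]_x f x =
   \int[mu]_x \int[lam n]_t f (cons_pair (x, t)))%E.
Proof.
move=> mf f0; rewrite /=.
rewrite (@ge0_integral_pushforward _ _ _ _ _ _ (@measurable_cons_pair R n)
  (mu \x lam n)%E setT f measurableT mf)//.
rewrite preimage_setT fubini_tonelli1//.
by apply: measurableT_comp => //; exact: measurable_cons_pair.
by move=> x; exact: f0.
Qed.

Definition tuple_of_row d (x : 'rV[R]_d) : tupleR d := [tuple x 0 i | i < d].

Lemma tuple_of_rowK d : cancel (@tuple_of_row d) rv.
Proof. by move=> x; apply/rowP => i; rewrite mxE tnth_mktuple. Qed.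

Lemma row_of_tupleK d : cancel rv (@tuple_of_row d).
Proof. by move=> x; apply/eq_from_tnth => i; rewrite tnth_mktuple mxE. Qed.

Lemma measurable_tuple_of_row d0 (T0 : measurableType d0) d (F : T0 -> 'rV[R]_d) :
  (forall i, measurable_fun setT (fun t => F t 0 i)) ->
  measurable_fun setT (fun t => tuple_of_row (F t)).
Proof.
move=> mF; apply/measurable_fun_tnthP => i.
rewrite (_ : _ \o _ = fun t => F t 0 i); first exact: mF.
by apply/funext => t /=; rewrite tnth_mktuple.
Qed.

Lemma measurable_row_entry d (i : 'I_d) :
  measurable_fun setT (fun t : tupleR d => rv t 0 i).
Proof.
rewrite (_ : (fun _ => _) = (@tnth d R)^~ i); first exact: measurable_tnth.
by apply/funext => t; rewrite mxE.
Qed.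

Definition translate d (a : 'rV[R]_d) (t : tupleR d) := tuple_of_row (a + rv t).

Lemma measurable_translate d (a : 'rV[R]_d) : measurable_fun setT (translate a).
Proof.
apply: measurable_tuple_of_row => i.
under eq_fun do rewrite mxE.
by apply: measurable_funD => //; exact: measurable_row_entry.
Qed.

Lemma lebesgue_tuple_shift d (a : 'rV[R]_d) A : measurable A ->
  lam d (translate a @^-1` A) = lam d A.
Proof.
elim: d a A => [|d ih] a A mA.
  by congr lebesgue_tuple; apply/seteqP; split => t /=;
    rewrite (tuple0 (translate a t)) (tuple0 t).
have ma := measurable_fun_preimage (measurable_translate a) mA.
have mc x : measurable_fun setT (fun t : tupleR d => cons_pair (x, t)).
  apply: (measurableT_comp (@measurable_cons_pair R d)); exact: pair1_measurable.
rewrite !lebesgue_tuple_cons//.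
pose g x := lam d ((fun t => cons_pair (x, t)) @^-1` A).
rewrite -[RHS](ge0_integral_lebesgue_shift (a 0 ord0) (f := g)).
- apply: eq_integral => x _; rewrite /g.
  rewrite -[RHS](ih (\row_i a 0 (lift ord0 i))); last exact: measurable_fun_preimage.
  congr lebesgue_tuple; apply/funext => t /=; congr A.
  apply/eq_from_tnth => i; rewrite /translate tnth_mktuple !mxE.
  case: (unliftP ord0 i) => [j ->|->]; last by rewrite !(tnth_nth 0).
  by rewrite /cons_pair !tnthS tnth_mktuple !mxE.
- rewrite /g (_ : (fun x : R => _) = lam d \o xsection (@cons_pair R d @^-1` A)).
    apply: measurable_fun_xsection; apply: measurable_fun_preimage => //.
    exact: measurable_cons_pair.
  by apply/funext => x /=; rewrite xsectionE.
- by move=> x; rewrite /g; apply: measure_ge0; exact: measurable_fun_preimage.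
Qed.

Definition tmulmx m n (M : 'M[R]_(m, n)) (t : tupleR m) := tuple_of_row (rv t *m M).

Lemma measurable_tmulmx m n (M : 'M[R]_(m, n)) : measurable_fun setT (tmulmx M).
Proof.
apply: measurable_tuple_of_row => i.
under eq_fun do rewrite mxE.
apply: measurable_sum => j; apply: measurable_funM => //.
exact: measurable_row_entry.
Qed.

(** A translation-invariant measure is multiplied by a constant under a linear
    map; the constant can be read off from any one symmetric set B of positive
    finite measure.  Computing the measure of
    {(x, y) : xM + y in A, y in B} by sections over y gives
    |A M^-1| |B|; the shear y -> y + xM turns this set into
    {(x, y) : y in A, y - xM in B}, whose measure is |B M^-1| |A| by the
    symmetry of B.  Dividing by |B| gives the claim. *)
Lemma lebesgue_tuple_linear_scale d (M : 'M[R]_d) (c : \bar R) (B : set (tupleR d)) :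
    M \in unitmx -> measurable B ->
    (forall t, B (tuple_of_row (- rv t)) = B t) ->
    (0 < lam d B < +oo)%E -> lam d (tmulmx M @^-1` B) = (c * lam d B)%E ->
  forall A, measurable A -> lam d (tmulmx M @^-1` A) = (c * lam d A)%E.
Proof.
move=> uM mB symB /andP[B0 Boo] McB A mA.
pose dif (z : tupleR d * tupleR d) := tuple_of_row (rv z.2 - rv z.1 *m M).
pose add (z : tupleR d * tupleR d) := tuple_of_row (rv z.1 *m M + rv z.2).
have mfstM i : measurable_fun setT
    (fun z : tupleR d * tupleR d => (rv z.1 *m M) 0 i).
  under eq_fun do rewrite mxE.
  apply: measurable_sum => j; apply: measurable_funM => //.
  apply: (measurableT_comp (measurable_row_entry j)); exact: measurable_fst.
have msnd i : measurable_fun setT (fun z : tupleR d * tupleR d => rv z.2 0 i).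
  by apply: (measurableT_comp (measurable_row_entry i)); exact: measurable_snd.
have mdif : measurable_fun setT dif.
  apply: measurable_tuple_of_row => i.
  under eq_fun do rewrite mxE [X in _ + X]mxE.
  exact: measurable_funB.
have madd : measurable_fun setT add.
  apply: measurable_tuple_of_row => i.
  under eq_fun do rewrite mxE.
  exact: measurable_funD.
pose E : set (tupleR d * tupleR d) := add @^-1` A `&` snd @^-1` B.
pose E' : set (tupleR d * tupleR d) := snd @^-1` A `&` dif @^-1` B.
have mE : measurable E.
  by apply: measurableI; apply: measurable_fun_preimage => //; exact: measurable_snd.
have mE' : measurable E'.
  by apply: measurableI; apply: measurable_fun_preimage => //; exact: measurable_snd.
have swap X : measurable X -> (lam d \x lam d)%E X = (lam d \x^ lam d)%E X.
  by apply: product_measure_unique => //= *; rewrite product_measure2E.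
(* Both sets have the same sections over x up to a translation by xM. *)
have EE' : (lam d \x lam d)%E E = (lam d \x lam d)%E E'.
  rewrite /product_measure1; apply: eq_integral => x _ /=.
  rewrite -(lebesgue_tuple_shift (rv x *m M) (A := xsection E' x)); last first.
    exact: measurable_xsection.
  congr lebesgue_tuple; rewrite !xsectionE; apply/seteqP; split => y /=;
    rewrite /E /E' /add /dif /translate /= tuple_of_rowK addrAC subrr add0r
      row_of_tupleK;
    by move=> [].
have ind X (k : \bar R) : measurable X -> (0 <= k)%E ->
    (\int[lam d]_y (k * (\1_X y)%:E) = k * lam d X)%E.
  move=> mX k0; rewrite ge0_integralZl//; last exact/measurable_EFinP.
  by rewrite integral_indic// setIT.
have mMA X : measurable X -> measurable (tmulmx M @^-1` X).
  by move=> mX; apply: measurable_fun_preimage => //; exact: measurable_tmulmx.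
(* The section over y is a translate of the preimage of A if y is in B, and is
   empty otherwise. *)
have iE : (lam d \x^ lam d)%E E = (lam d (tmulmx M @^-1` A) * lam d B)%E.
  rewrite /product_measure2 -ind//.
  apply: eq_integral => y _ /=; rewrite indicE ysectionE.
  have [|] := boolP (y \in B); rewrite (inE, notin_setE) => yB.
    rewrite mule1 -(lebesgue_tuple_shift (rv y *m invmx M) (mMA _ mA)).
    congr lebesgue_tuple; apply/seteqP; rewrite /E /add /tmulmx /translate;
      split => x /=;
      rewrite tuple_of_rowK mulmxDl mulmxKV// addrC; first by case.
    by [].
  rewrite mule0 -[RHS](measure0 (lam d)); congr lebesgue_tuple.
  by apply/seteqP; split => // x [].
have cB0 : (0 <= c * lam d B)%E by rewrite -McB; exact: measure_ge0.
have iE' : (lam d \x^ lam d)%E E' = (c * lam d B * lam d A)%E.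
  rewrite /product_measure2 -(ind A _ mA cB0).
  apply: eq_integral => y _ /=; rewrite indicE ysectionE.
  have [|] := boolP (y \in A); rewrite (inE, notin_setE) => yA.
    rewrite mule1 -McB -(lebesgue_tuple_shift (- (rv y *m invmx M)) (mMA _ mB)).
    congr lebesgue_tuple; apply/seteqP; rewrite /E' /dif /tmulmx /translate;
      split => x /=.
      move=> [_]; rewrite -symB !tuple_of_rowK mulmxDl mulNmx mulmxKV//.
      by rewrite opprB addrC.
    rewrite -symB !tuple_of_rowK mulmxDl mulNmx mulmxKV//.
    by rewrite opprD opprK.
  rewrite mule0 -[RHS](measure0 (lam d)); congr lebesgue_tuple.
  by apply/seteqP; split => // x [].
have := iE'; rewrite -swap// -EE' swap// iE.
have Bfin : lam d B \is a fin_num by rewrite ge0_fin_numE// ltW.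
rewrite -(fineK Bfin) -muleA [X in _ = (_ * X)%E]muleC muleA =>
  /(congr1 (fun x => x * ((fine (lam d B))^-1)%:E)%E).
have B1 : fine (lam d B) != 0.
  by rewrite gt_eqF// -lte_fin fineK.
by rewrite -!muleA -!EFinM divff// !mule1.
Qed.

(** * Boxes, orthogonal and diagonal maps, orthonormal frames *)

Lemma measurable_box d (A : 'I_d -> set RM) : (forall i, measurable (A i)) ->
  measurable [set t : tupleR d | forall i, A i (tnth t i)].
Proof.
move=> mA; rewrite (_ : [set _ | _] =
    \bigcap_(i in [set: 'I_d]) (@tnth _ _)^~ i @^-1` A i).
  apply: fin_bigcap_measurable => // i _.
  by apply: measurable_fun_preimage => //; exact: measurable_tnth.
by apply/seteqP; split => [t tA i _|t tA i]; [exact: tA|exact: (tA i)].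
Qed.

Lemma lebesgue_tuple_itv d (a b : 'I_d -> R) : (forall i, a i <= b i) ->
  lam d [set t | forall i, a i <= tnth t i <= b i] = (\prod_(i < d) (b i - a i))%:E.
Proof.
move=> ab; have := @lebesgue_tuple_box R d (fun i => `[a i, b i]%classic : set RM).
have -> : [set t : tupleR d | forall i, (`[a i, b i]%classic : set RM) (tnth t i)] =
    [set t | forall i, a i <= tnth t i <= b i].
  by apply/seteqP; split => t /= h i; have := h i; rewrite in_itv.
move=> ->; last by move=> i; exact: measurable_itv.
rewrite -prodEFin; apply: eq_bigr => i _.
rewrite lebesgue_measure_itv/= lte_fin.
have := ab i; rewrite le_eqVlt => /orP[/eqP <-|->]; last by rewrite EFinB.
by rewrite ltxx subrr.
Qed.

Lemma measurable_itv_box d (a b : 'I_d -> R) :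
  measurable [set t : tupleR d | forall i, a i <= tnth t i <= b i].
Proof.
rewrite (_ : [set _ | _] =
  [set t : tupleR d | forall i, (`[a i, b i]%classic : set RM) (tnth t i)]).
  apply: (@measurable_box d (fun i => `[a i, b i]%classic)) => i.
  exact: measurable_itv.
by apply/seteqP; split => t /= h i; have := h i; rewrite in_itv.
Qed.

Lemma orthogonal_unitmx d (M : 'M[R]_d) : M *m M^T = 1%:M -> M \in unitmx.
Proof. by move=> /mulmx1_unit[]. Qed.

Lemma dotr_orthogonal d (M : 'M[R]_d) (x : 'rV[R]_d) : M *m M^T = 1%:M ->
  dotr (x *m M) (x *m M) = dotr x x.
Proof.
move=> MM; have := mulmx_dotr (x *m M) (x *m M).
rewrite trmx_mul mulmxA -(mulmxA x) MM mulmx1 mulmx_dotr.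
by move=> /matrixP/(_ 0 0); rewrite !mxE eqxx !mulr1n.
Qed.

Lemma measurable_dotr d : measurable_fun setT (fun t : tupleR d => dotr (rv t) (rv t)).
Proof.
by apply: measurable_sum => i; apply: measurable_funM; exact: measurable_row_entry.
Qed.

(** The Euclidean unit ball is mapped to itself, so the scaling constant is 1. *)
Lemma lebesgue_tuple_orthogonal d (M : 'M[R]_d) A : M *m M^T = 1%:M ->
  measurable A -> lam d (tmulmx M @^-1` A) = lam d A.
Proof.
move=> MM mA.
pose B : set (tupleR d) := [set t | dotr (rv t) (rv t) <= 1].
have mB : measurable B.
  rewrite (_ : B = (fun t : tupleR d => dotr (rv t) (rv t)) @^-1` `]-oo, 1%R]).
    by apply: measurable_fun_preimage; [exact: measurable_dotr|exact: measurable_itv].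
  by apply/seteqP; split => t /=; rewrite in_itv.
have symB t : B (tuple_of_row (- rv t)) = B t.
  rewrite /B/= tuple_of_rowK; congr (is_true (_ <= _)).
  by apply: eq_bigr => i _; rewrite !mxE mulrNN.
(* The cube of half side K lies in the unit ball, since d K^2 <= d K <= 1. *)
pose K : R := d.+1%:R^-1.
have K0 : 0 < K by rewrite invr_gt0.
have dotE (t : tupleR d) : dotr (rv t) (rv t) = \sum_i tnth t i ^+ 2.
  by apply: eq_bigr => i _; rewrite mxE expr2.
rewrite (@lebesgue_tuple_linear_scale d M 1%E B) ?mul1e//.
- exact: orthogonal_unitmx.
- apply/andP; split.
    apply: (@lt_le_trans _ _ (lam d [set t | forall i, - K <= tnth t i <= K])).
      rewrite lebesgue_tuple_itv => [|i]; last lra.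
      rewrite lte_fin prodr_gt0// => i _; lra.
    apply: le_measure; rewrite ?inE//; first exact: measurable_itv_box.
    move=> t /= tK; rewrite /B/= dotE.
    apply: (@le_trans _ _ (\sum_(i < d) K)).
      apply: ler_sum => i _; rewrite -real_normK ?num_real//.
      have tiK : `|tnth t i| <= K by rewrite ler_norml.
      have K1 : K <= 1 by rewrite invf_le1// ler1n.
      by rewrite expr2 -[leRHS]mulr1 ler_pM//; exact: le_trans K1.
    rewrite sumr_const card_ord -mulr_natl /K ler_pdivrMr// mul1r ler_nat//.
  apply: (@le_lt_trans _ _ (lam d [set t | forall i, - 1 <= tnth t i <= 1])).
    apply: le_measure; rewrite ?inE//; first exact: measurable_itv_box.
    move=> t; rewrite /B/= dotE => tB i.
    have : tnth t i ^+ 2 <= 1.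
      apply: le_trans tB; rewrite (bigD1 i)//= lerDl sumr_ge0// => j _.
      exact: sqr_ge0.
    rewrite -ler_norml => ti1.
    by rewrite -(@ler_pXn2r _ 2) ?nnegrE// expr1n real_normK ?num_real.
  by rewrite lebesgue_tuple_itv ?ltry// => i; lra.
- congr lebesgue_tuple; apply/seteqP; rewrite /B /tmulmx; split => t /=;
    by rewrite tuple_of_rowK dotr_orthogonal.
Qed.

Lemma ge0_integral_orthogonal d (M : 'M[R]_d) (h : tupleR d -> \bar R) :
  M *m M^T = 1%:M -> measurable_fun setT h -> (forall t, (0 <= h t)%E) ->
  (\int[lam d]_t h (tmulmx M t) = \int[lam d]_t h t)%E.
Proof.
move=> MM mh h0.
rewrite (ge0_integral_scale_measure (k := 1%:nng) (measurable_tmulmx M) _ mh h0)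
  ?mul1e//.
by move=> A mA; rewrite mul1e; exact: lebesgue_tuple_orthogonal.
Qed.

(** The scaling constant is read off from the cube [-1, 1]^d. *)
Lemma lebesgue_tuple_diag d (w : 'rV[R]_d) A : (forall i, w 0 i != 0) ->
  measurable A ->
  lam d (tmulmx (diag_mx w) @^-1` A) = ((\prod_i `|w 0 i|^-1)%:E * lam d A)%E.
Proof.
move=> w0 mA.
pose B : set (tupleR d) := [set t | forall i, - 1 <= tnth t i <= 1].
apply: (lebesgue_tuple_linear_scale (B := B)) => //.
- rewrite unitmxE det_diag unitfE; apply/prodf_neq0 => i _; exact: w0.
- exact: measurable_itv_box.
- move=> t; apply/propext; split => h i; have := h i; rewrite ?tnth_mktuple ?mxE;
    by rewrite -!ler_norml ?normrN.
- rewrite lebesgue_tuple_itv => [|i]; last lra.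
  by rewrite ltry andbT lte_fin prodr_gt0// => i _; lra.
- have -> : tmulmx (diag_mx w) @^-1` B =
      [set t | forall i, - `|w 0 i|^-1 <= tnth t i <= `|w 0 i|^-1].
    have e (x z : R) : z != 0 ->
        (- 1 <= x * z <= 1) = (- `|z|^-1 <= x <= `|z|^-1).
      by move=> z0; rewrite -!ler_norml normrM -ler_pdivlMr ?normr_gt0// div1r.
    by apply/seteqP; split => t /= h i; have := h i;
      rewrite /tmulmx tnth_mktuple mul_mx_diag !mxE e.
  rewrite !lebesgue_tuple_itv => [|i|i]; [|lra|]; last first.
    have : 0 <= `|w 0 i|^-1 by rewrite invr_ge0.
    lra.
  rewrite -EFinM -big_split; congr EFin; apply: eq_bigr => i _ /=; ring.
Qed.

Lemma tmulmx_frame n (v : 'rV[R]_n.+1) (U : 'M[R]_(n, n.+1)) s y :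
  tmulmx (col_mx v U : 'M[R]_n.+1) (cons_pair (s, y)) =
  tuple_of_row (rv y *m U + s *: v).
Proof.
congr tuple_of_row; rewrite addrC.
rewrite (_ : rv (cons_pair (s, y)) = row_mx (s%:M : 'rV_1) (rv y)).
  have := mul_row_col (s%:M : 'rV_1) (rv y) v U.
  by rewrite mul_scalar_mx => <-.
apply/rowP => i; rewrite !mxE; case: splitP => j ij.
  rewrite (_ : i = ord0); first by rewrite (tnth_nth 0) !mxE /= (ord1 j).
  by apply: val_inj; rewrite /= ij (ord1 j).
rewrite !mxE (_ : i = lift ord0 j) ?tnthS//.
by apply: val_inj; rewrite /= ij.
Qed.

Lemma measurable_frame n (v : 'rV[R]_n.+1) (U : 'M[R]_(n, n.+1)) :
  measurable_fun setT
    (fun z : RM * tupleR n => tuple_of_row (rv z.2 *m U + z.1 *: v) : tupleR n.+1).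
Proof.
rewrite (_ : (fun _ => _) = tmulmx (col_mx v U : 'M[R]_n.+1) \o @cons_pair R n).
  apply: measurableT_comp; [exact: measurable_tmulmx|exact: measurable_cons_pair].
by apply/funext => -[s y] /=; rewrite tmulmx_frame.
Qed.

(** Integration over the whole space is integration over the hyperplane
    orthogonal to v of integrals along the lines parallel to v: the frame
    (v, U) is an orthogonal matrix. *)
Lemma ge0_integral_frame n (v : 'rV[R]_n.+1) (U : 'M[R]_(n, n.+1))
    (h : tupleR n.+1 -> \bar R) :
  dotr v v = 1 -> perp_basis v U ->
  measurable_fun setT h -> (forall t, (0 <= h t)%E) ->
  (\int[lam n.+1]_t h t =
   \int[lam n]_y \int[mu]_s h (tuple_of_row (rv y *m U + s *: v)))%E.
Proof.
move=> v1 [UU Uv] mh h0.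
(* The product lives in dimension 1 + n, convertible to n.+1. *)
have QQ : (col_mx v U : 'M[R]_n.+1) *m (col_mx v U : 'M[R]_n.+1)^T = 1%:M.
  have : col_mx v U *m (col_mx v U)^T = 1%:M; last by [].
  rewrite tr_col_mx mul_col_row mulmx_dotr v1 UU Uv.
  by rewrite -[v *m U^T]trmxK trmx_mul trmxK Uv trmx0 -scalar_mx_block.
rewrite -(ge0_integral_orthogonal QQ mh h0) ge0_integral_cons; last 2 first.
- by apply: measurableT_comp => //; exact: measurable_tmulmx.
- by move=> t; exact: h0.
rewrite (fubini_tonelli (fun z : RM * tupleR n =>
  h (tmulmx (col_mx v U : 'M[R]_n.+1) (cons_pair z)))).
- apply: eq_integral => y _; apply: eq_integral => s _.
  by rewrite tmulmx_frame.
- apply: measurableT_comp => //; apply: measurableT_comp.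
    exact: measurable_tmulmx.
  exact: measurable_cons_pair.
- by move=> z; exact: h0.
Qed.

(** * Strictly convex functions of one variable *)

(** Throughout, g is the increasing derivative of f and s0 its zero, so f
    decreases to its minimum f s0 and then increases to infinity. *)
Section convex_line.
Variables (f g : R -> R) (s0 : R).
Hypothesis df : forall x : R, is_derive x 1 f (g x).
Hypothesis cg : continuous g.
Hypothesis incg : {mono g : x y / x < y}.
Hypothesis g0 : g s0 = 0.

Let cf : continuous f.
Proof.
by move=> x; apply/differentiable_continuous/derivable1_diffP/ex_derive; exact: df.
Qed.

Let mvt a b : a < b -> exists2 c, a < c < b & f b - f a = g c * (b - a).
Proof.
move=> ab; have [c] := MVT ab (fun x _ => df x) (continuous_subspaceT cf).
by rewrite in_itv/= => cab E; exists c.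
Qed.

Lemma convex_line_incr a b : s0 <= a -> a < b -> f a < f b.
Proof.
move=> sa ab; have [c /andP[ac cb] E] := mvt ab.
rewrite -subr_gt0 E mulr_gt0 ?subr_gt0// -g0 incg.
exact: le_lt_trans ac.
Qed.

Lemma convex_line_right r : f s0 <= r ->
  exists b, [/\ s0 <= b, f b = r & forall s, s0 <= s -> (f s <= r) = (s <= b)].
Proof.
move=> fr.
have [M sM rM] : exists2 M, s0 <= M & r <= f M.
  (* Beyond s0 + 1 the slope is at least g (s0 + 1) > 0; M is the point where the
     corresponding line certainly exceeds r. *)
  have g1 : 0 < g (s0 + 1) by rewrite -g0 incg ltrDl.
  pose M := s0 + 1 + (1 + `|r - f (s0 + 1)|) / g (s0 + 1).
  have M1 : s0 + 1 < M.
    by rewrite /M ltrDl divr_gt0// addrC ltr_wpDl.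
  exists M; first lra.
  have [c /andP[ac cb] E] := mvt M1.
  have gc : g (s0 + 1) <= g c by rewrite ltW// incg.
  have : 1 + `|r - f (s0 + 1)| <= f M - f (s0 + 1).
    have -> : 1 + `|r - f (s0 + 1)| = g (s0 + 1) * (M - (s0 + 1)).
      by rewrite /M; field; rewrite gt_eqF.
    by rewrite E ler_wpM2r// subr_ge0 ltW.
  have := ler_norm (r - f (s0 + 1)); lra.
have [|b] := @IVT _ f s0 M r sM (continuous_subspaceT cf).
  by rewrite ge_min fr/= le_max rM orbT.
rewrite in_itv/= => /andP[sb bM] fb; exists b; split => // s ss.
rewrite -fb; have [sb'|bs] := leP s b; last by apply/negbTE; rewrite -ltNge;
  exact: convex_line_incr.
have [->|sb''] := eqVneq s b; first exact: lexx.
by apply/ltW/convex_line_incr => //; rewrite lt_neqAle sb''.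
Qed.

End convex_line.

Lemma FTC_continuous (f g : R -> R) a b : a <= b ->
  (forall x : R, is_derive x 1 f (g x)) -> continuous g ->
  (\int[mu]_(x in `[a, b]) (g x)%:E = (f b - f a)%:E)%E.
Proof.
move=> ab df cg.
have cf : continuous f.
  by move=> x; apply/differentiable_continuous/derivable1_diffP/ex_derive; exact: df.
have [->|neq] := eqVneq a b.
  rewrite subrr set_itv1 integral_set1//.
rewrite (continuous_FTC2 (F := f)) ?lt_neqAle ?neq//.
- exact: continuous_subspaceT.
- split; first by move=> x _; apply: ex_derive; exact: df.
  + exact/cvg_at_right_filter/cf.
  + exact/cvg_at_left_filter/cf.
- by move=> x _; rewrite derive1E (derive_val (is_derive := df x)).
Qed.

(** The left branch of f is the right branch of s -> f (- s), whose derivative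
    is s -> - g (- s), increasing with zero - s0. *)
Section reflection.
Variables (f g : R -> R) (s0 : R).
Hypothesis df : forall x : R, is_derive x 1 f (g x).
Hypothesis cg : continuous g.
Hypothesis incg : {mono g : x y / x < y}.
Hypothesis g0 : g s0 = 0.

Lemma is_derive_reflect (x : R) : is_derive x 1 (f \o -%R) (- g (- x)).
Proof. by rewrite -mulrN1; apply: is_derive1_comp. Qed.

Lemma mono_reflect : {mono (fun x => - g (- x)) : x y / x < y}.
Proof. by move=> x y; rewrite ltrN2 incg ltrN2. Qed.

Lemma zero_reflect : - g (- - s0) = 0.
Proof. by rewrite opprK g0 oppr0. Qed.

Lemma convex_line_min s : f s0 <= f s.
Proof.
have [ss|ss|->//] := ltgtP s s0; last first.
  exact/ltW/(convex_line_incr df incg g0 (lexx s0) ss).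
rewrite -[s0]opprK -[s]opprK; apply/ltW.
by apply: (convex_line_incr is_derive_reflect mono_reflect zero_reflect);
  rewrite ?lexx ?ltrN2.
Qed.

(** The sublevel set {f <= r} is a segment with f = r at both ends and the
    minimum in between, so the total variation of f on it is twice the drop
    from r to the minimum: two applications of the fundamental theorem of
    calculus. *)
Lemma integral_convex_line r :
  (\int[mu]_s (if f s <= r then `|g s| else 0)%:E =
   (2 * Num.max (r - f s0) 0)%:E)%E.
Proof.
have [fr|fr] := leP (f s0) r; last first.
  rewrite max_r ?subr_le0 1?ltW// mulr0 integral0_eq// => s _.
  by rewrite leNgt (lt_le_trans fr) ?convex_line_min.
rewrite max_l ?subr_ge0//.
have [b [sb fb bP]] := convex_line_right df incg g0 fr.
have fr' : (f \o -%R) (- s0) <= r by rewrite /= opprK.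
have [a' [sa fa aP]] := convex_line_right is_derive_reflect mono_reflect zero_reflect
  fr'.
have as0 : - a' <= s0 by rewrite lerNl.
have leg : {mono g : x y / x <= y} by apply: le_mono => x y; rewrite incg.
have mg : measurable_fun setT (g : RM -> RM).
  exact: continuous_measurable_fun.
transitivity (\int[mu]_(s in `[(- a')%R, b]) (`|g s|)%:E)%E.
  rewrite [RHS]integral_mkcond; apply: eq_integral => s _.
  rewrite patchE mem_setE/= in_itv/=.
  have [ss|ss] := leP s0 s.
    by rewrite bP// (le_trans as0 ss)/=; case: ifP.
  have := aP (- s); rewrite lerN2 /= opprK => -> ; last exact: ltW.
  by rewrite lerNl (le_trans (ltW ss) sb) andbT; case: ifP.
rewrite (_ : `[- a', b]%classic = `[- a', s0]%classic `|` `]s0, b]%classic); last first.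
  by rewrite -itv_bndbnd_setU.
rewrite ge0_integral_setU//=; last 2 first.
- by apply/measurable_EFinP; apply: measurableT_comp => //; exact: measurable_funTS.
- apply/disj_setPRL => x /=; rewrite !in_itv/= => /andP[xs _] /andP[_].
  by rewrite leNgt xs.
rewrite integral_itv_obnd_cbnd; last first.
  by apply/measurable_EFinP; apply: measurableT_comp => //; exact: measurable_funTS.
rewrite (eq_integral (fun s : RM => (- g s)%:E)); last first.
  move=> s; rewrite inE/= in_itv/= => /andP[_ ss].
  by rewrite ler0_norm// -g0 leg.
rewrite [X in (_ + X)%E](eq_integral (fun s : RM => (g s)%:E)); last first.
  move=> s; rewrite inE/= in_itv/= => /andP[ss _].
  by rewrite ger0_norm// -g0 leg.
rewrite (FTC_continuous as0 (f := - f) (g := - g)).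
- rewrite (FTC_continuous sb df cg) -EFinD; congr EFin.
  by move: fa; rewrite fb /= => <-; rewrite !fctE; ring.
- by move=> x; exact/continuousN/cg.
Qed.

End reflection.

(** * Skewed powers *)

Definition pospow (a x : R) := Num.max x 0 `^ a.

Lemma pospow_ge0 a x : 0 <= pospow a x. Proof. exact: powR_ge0. Qed.

Lemma pospow_le0 a x : a != 0 -> x <= 0 -> pospow a x = 0.
Proof. by move=> a0 x0; rewrite /pospow max_r// powR0. Qed.

Lemma pospow_ge0E a x : 0 <= x -> pospow a x = x `^ a.
Proof. by move=> x0; rewrite /pospow max_l. Qed.

Lemma continuous_pospow a : 0 < a -> continuous (pospow a).
Proof.
move=> a0 x; have [x0|x0|->] := ltgtP x 0.
- have : pospow a y @[y --> x] --> (0 : R).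
    apply: cvg_near_cst.
    by near=> y; rewrite pospow_le0// ?gt_eqF//; apply: ltW; near: y; exact: lt_nbhsl.
  by rewrite /continuous_at pospow_le0// ?gt_eqF// ltW.
- have cx : {for x, continuous (@powR R ^~ a)}.
    by apply/differentiable_continuous/derivable1_diffP/ex_derive;
      exact: is_derive1_powR.
  rewrite /continuous_at pospow_ge0E ?ltW//.
  apply: cvg_trans cx; apply: near_eq_cvg.
  near=> y; rewrite pospow_ge0E//; apply: ltW; near: y; exact: lt_nbhsr.
- rewrite /continuous_at pospow_le0 ?gt_eqF//.
  apply/cvgrPdist_lt => e e0; near=> y.
  rewrite sub0r normrN ger0_norm ?pospow_ge0//.
  have -> : e = (e `^ a^-1) `^ a by rewrite -powRrM mulVf ?gt_eqF// powRr1// ltW.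
  rewrite /pospow gt0_ltr_powR// ?nnegrE ?powR_ge0// ?le_max ?lexx ?orbT//.
  rewrite gt_max powR_gt0// andbT; near: y.
  by apply: lt_nbhsl; rewrite powR_gt0.
Unshelve. all: by end_near. Qed.

Lemma is_derive_pospow (a x : R) : 1 < a ->
  is_derive x (1 : R) (pospow a) (a * pospow (a - 1) x).
Proof.
move=> a1; have a0 : a != 0 by rewrite gt_eqF// (lt_trans ltr01).
have b0 : a - 1 != 0 by rewrite gt_eqF// subr_gt0.
have [x0|x0|->] := ltgtP x 0.
- rewrite pospow_le0// ?ltW// mulr0.
  apply: (near_eq_is_derive (f := cst 0)).
  near=> y; rewrite /cst pospow_le0//; apply: ltW; near: y; exact: lt_nbhsl.
- rewrite pospow_ge0E ?ltW//.
  apply: (near_eq_is_derive (f := @powR R ^~ a)).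
    near=> y; rewrite pospow_ge0E//; apply: ltW; near: y; exact: lt_nbhsr.
  exact: is_derive1_powR.
- have cv : h^-1 *: ((pospow a \o shift 0) (h *: 1) - pospow a 0) @[h --> (0:R)^'] -->
  a * pospow (a - 1) 0.
    rewrite (@pospow_le0 (a - 1))// mulr0.
    have := @continuous_pospow (a - 1); rewrite subr_gt0 => /(_ a1 0).
    rewrite /continuous_at (@pospow_le0 (a - 1) 0)// => c0.
    have {}c0 : pospow (a - 1) h @[h --> (0:R)^'] --> (0:R).
      exact: (cvg_trans (cvg_app _ (@nbhs_dnbhs _ (0:R))) c0).
    apply: cvg_trans c0; apply: near_eq_cvg.
    near=> h; rewrite /= addr0 scaler1 [pospow a 0]pospow_le0// subr0.
    have h0 : h != 0 by near: h; exact: nbhs_dnbhs_neq.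
    have [hn|hp|hE] := ltgtP h 0; last by rewrite hE eqxx in h0.
      by rewrite !pospow_le0 ?scaler0// ltW.
    rewrite !pospow_ge0E ?ltW// powRB ?powRr1 ?(ltW hp)//; last by rewrite h0 implybT.
    by rewrite mulrC.
  by apply: DeriveDef; [apply/cvg_ex; eexists; exact: cv|exact/cvg_lim].
Unshelve. all: by end_near. Qed.

(** On the positive half line this is x^q, on the negative one (|x| / tau)^q.
    For tau = 1 it is |x|^q; as tau tends to 0 it penalises negative
    arguments ever more, so that the unit balls of its sums shrink to the
    nonnegative part of the l_q ball. *)
Definition skewpow (q tau x : R) := pospow q x + pospow q (- x / tau).
Definition dskewpow (q tau x : R) :=
  q * (pospow (q - 1) x - tau^-1 * pospow (q - 1) (- x / tau)).

Section skewpow.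
Variables (q tau : R).
Hypotheses (q1 : 1 < q) (tau0 : 0 < tau).

Let q0 : 0 < q. Proof. by apply: lt_trans q1. Qed.
Let qn0 : q != 0. Proof. by rewrite gt_eqF. Qed.
Let q10 : 0 < q - 1. Proof. by rewrite subr_gt0. Qed.
Let qn10 : q - 1 != 0. Proof. by rewrite gt_eqF. Qed.
Let ti0 : 0 < tau^-1. Proof. by rewrite invr_gt0. Qed.

Lemma skewpow_ge0 x : 0 <= skewpow q tau x.
Proof. by rewrite addr_ge0 ?pospow_ge0. Qed.

Lemma skewpow_ge0_arg x : 0 <= x -> skewpow q tau x = x `^ q.
Proof.
move=> x0; rewrite /skewpow pospow_ge0E// pospow_le0 ?addr0//.
by rewrite pmulr_lle0// oppr_le0.
Qed.

Lemma skewpow_le0_arg x : 0 <= x -> skewpow q tau (- tau * x) = x `^ q.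
Proof.
move=> x0; rewrite /skewpow pospow_le0 ?add0r//;
  last by rewrite mulNr oppr_le0 mulr_ge0// ltW.
rewrite (_ : - (- tau * x) / tau = x); last by field; rewrite gt_eqF.
by rewrite pospow_ge0E.
Qed.

Lemma dskewpow_ge0_arg x : 0 <= x -> dskewpow q tau x = q * x `^ (q - 1).
Proof.
move=> x0; rewrite /dskewpow pospow_ge0E// pospow_le0 ?mulr0 ?subr0//.
by rewrite pmulr_lle0// oppr_le0.
Qed.

Lemma dskewpow_le0_arg x : 0 <= x ->
  dskewpow q tau (- tau * x) = - (q / tau * x `^ (q - 1)).
Proof.
move=> x0; rewrite /dskewpow pospow_le0 ?add0r//;
  last by rewrite mulNr oppr_le0 mulr_ge0// ltW.
rewrite (_ : - (- tau * x) / tau = x); last by field; rewrite gt_eqF.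
rewrite pospow_ge0E//. ring.
Qed.

Lemma skewpow_homo r x : 0 <= r -> skewpow q tau (r * x) = r `^ q * skewpow q tau x.
Proof.
move=> r0; have e z : pospow q (r * z) = r `^ q * pospow q z.
  rewrite /pospow -[in LHS](mulr0 r) -maxr_pMr// powRM// le_max lexx orbT//.
by rewrite /skewpow mulrDr !e -mulrN -mulrA e.
Qed.

Lemma is_derive_skewpow (x : R) :
  is_derive x (1 : R) (skewpow q tau) (dskewpow q tau x).
Proof.
have d1 := is_derive_pospow x q1.
have d2 : is_derive x (1 : R) (pospow q \o (fun x => - x / tau))
    (q * pospow (q - 1) (- x / tau) * - tau^-1).
  apply: is_derive1_comp; first exact: is_derive_pospow.
  have -> : (fun x => - x / tau) = - tau^-1 \*: (@id R).
    by apply/funext => z /=; rewrite /GRing.scale/= mulrC mulNr mulrN.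
  by rewrite -[X in is_derive _ _ _ X]mulr1; apply: is_deriveZ.
rewrite (_ : dskewpow q tau x =
  q * pospow (q - 1) x + q * pospow (q - 1) (- x / tau) * - tau^-1).
  exact: is_deriveD d1 d2.
by rewrite /dskewpow; ring.
Qed.

Lemma continuous_dskewpow : continuous (dskewpow q tau).
Proof.
move=> x; apply: cvgM; first exact: cvg_cst.
apply: cvgB; first exact: continuous_pospow.
apply: cvgM; first exact: cvg_cst.
apply: (@cvg_comp _ _ _ (fun t => - t / tau) (pospow (q - 1)));
  last exact: continuous_pospow.
by apply: cvgM; [exact: opp_continuous|exact: cvg_cst].
Qed.

Lemma measurable_skewpow : measurable_fun setT (skewpow q tau : R -> R).
Proof.
apply: continuous_measurable_fun => x.
by apply/differentiable_continuous/derivable1_diffP/ex_derive; exact: is_derive_skewpow.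
Qed.

Lemma measurable_dskewpow : measurable_fun setT (dskewpow q tau : R -> R).
Proof. by apply: continuous_measurable_fun; exact: continuous_dskewpow. Qed.

Lemma ltr_dskewpow : {mono dskewpow q tau : x y / x < y}.
Proof.
have npw (x y : R) : x <= y -> pospow (q - 1) x <= pospow (q - 1) y.
  move=> xy; apply: ge0_ler_powR; first exact: ltW.
  - by rewrite nnegrE le_max lexx orbT.
  - by rewrite nnegrE le_max lexx orbT.
  - by rewrite ge_max !le_max xy lexx orbT.
have spw (x y : R) : 0 < y -> x < y -> pospow (q - 1) x < pospow (q - 1) y.
  move=> y0 xy; apply: gt0_ltr_powR => //.
  - by rewrite nnegrE le_max lexx orbT.
  - by rewrite nnegrE le_max lexx orbT.
  - by rewrite gt_max !lt_max xy y0.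
apply: leW_mono; apply: le_mono => x y xy.
have xyt : - y / tau < - x / tau by rewrite ltr_pM2r// ltrN2.
rewrite /dskewpow ltr_pM2l//; have [y0|y0] := ltP 0 y.
  by rewrite ltr_leB// ?spw// ler_pM2l// npw// ltW.
rewrite ler_ltB// ?npw ?(ltW xy)// ltr_pM2l// spw//.
by rewrite divr_gt0// oppr_gt0 (lt_le_trans xy).
Qed.

Lemma dskewpow_unbounded C : exists x, C <= dskewpow q tau x.
Proof.
exists ((`|C| / q) `^ (q - 1)^-1); rewrite dskewpow_ge0_arg ?powR_ge0//.
rewrite -powRrM mulVf// powRr1 ?divr_ge0// ?(ltW q0)//.
by rewrite mulrC divfK// ler_norm.
Qed.

Lemma dskewpow_unbounded_below C : exists x, dskewpow q tau x <= C.
Proof.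
exists (- tau * ((`|C| * tau / q) `^ (q - 1)^-1)); rewrite dskewpow_le0_arg ?powR_ge0//.
rewrite -powRrM mulVf// powRr1 ?divr_ge0 ?mulr_ge0// ?(ltW q0) ?(ltW tau0)//.
rewrite lerNl [leRHS](_ : _ = `|C|); last by field; rewrite qn0 gt_eqF.
by rewrite -normrN ler_norm.
Qed.

End skewpow.

Lemma skewpow1 q x : 1 < q -> skewpow q 1 x = `|x| `^ q.
Proof.
move=> q1; have [x0|x0] := leP 0 x; first by rewrite skewpow_ge0_arg// ger0_norm.
have -> : skewpow q 1 x = skewpow q 1 (- 1 * - x) by rewrite mulN1r opprK.
by rewrite skewpow_le0_arg// ?ltr0_norm// oppr_ge0 ltW.
Qed.

(** * Skew balls along lines *)

Definition skew_sum q tau d (x : 'rV[R]_d) := \sum_i skewpow q tau (x 0 i).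
(** The derivative of skew_sum in the direction v. *)
Definition dskew_sum q tau d (v x : 'rV[R]_d) := \sum_i v 0 i * dskewpow q tau (x 0 i).

Section line.
Variables (q tau : R) (d : nat).
Hypotheses (q1 : 1 < q) (tau0 : 0 < tau).
Implicit Types a v : 'rV[R]_d.

Lemma is_derive_skew_sum a v (s : R) :
  is_derive s (1 : R) (fun s : R => skew_sum q tau (a + s *: v))
    (dskew_sum q tau v (a + s *: v)).
Proof.
rewrite (_ : (fun s : R => _) =
    \sum_(i < d) (skewpow q tau \o (fun s => a 0 i + s * v 0 i))); last first.
  apply/funext => t; rewrite fct_sumE; apply: eq_bigr => i _ /=.
  by rewrite !mxE.
apply: is_derive_sum => i.
rewrite mulrC !mxE; apply: is_derive1_comp; first exact: is_derive_skewpow.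
rewrite (_ : (fun t => _) = cst (a 0 i) + v 0 i \*: (@id R)); last first.
  by apply/funext => t; rewrite !fctE /= /GRing.scale/= mulrC.
rewrite -[X in is_derive _ _ _ X]add0r -[X in is_derive _ _ _ (0 + X)]mulr1.
by apply: is_deriveD; apply: is_deriveZ.
Qed.

Lemma continuous_dskew_sum a v :
  continuous (fun s : R => dskew_sum q tau v (a + s *: v)).
Proof.
rewrite /dskew_sum; under eq_fun do under eq_bigr do rewrite !mxE.
move=> s; apply: cvg_big => [|i _]; first exact: add_continuous.
apply: cvgM; first exact: cvg_cst.
apply: (@cvg_comp _ _ _ (fun t => a 0 i + t * v 0 i) (dskewpow q tau));
  last exact: continuous_dskewpow.
by apply: cvgD; [exact: cvg_cst|apply: cvgM; [exact: cvg_id|exact: cvg_cst]].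
Qed.

Lemma dskew_sum_term_incr a v i (x y : R) : x < y ->
  v 0 i * dskewpow q tau ((a + x *: v) 0 i) <= v 0 i * dskewpow q tau ((a + y *: v) 0 i)
    ?= iff (v 0 i == 0).
Proof.
move=> xy; rewrite !mxE; have [v0|v0|->] := ltgtP (v 0 i) 0; last first.
  by rewrite !mul0r; exact/leif_refl.
- by apply/leifP; rewrite ltr_pM2l// (ltr_dskewpow q1 tau0) ltrD2l ltr_pM2r.
- by apply/leifP; rewrite ltr_nM2l// (ltr_dskewpow q1 tau0) ltrD2l ltr_nM2r.
Qed.

(** Every coordinate with v_i <> 0 contributes a strictly increasing term,
    whatever the sign of v_i; the others are constant. *)
Lemma ltr_dskew_sum a v : v != 0 ->
  {mono (fun s : R => dskew_sum q tau v (a + s *: v)) : x y / x < y}.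
Proof.
move=> /rV0Pn[i vi]; apply: leW_mono; apply: le_mono => x y xy.
rewrite /dskew_sum (bigD1 i)// [ltRHS](bigD1 i)//; apply: ltr_leD.
  by have /leifP := dskew_sum_term_incr a v i xy; rewrite (negbTE vi).
by apply: ler_sum => j _; exact: (dskew_sum_term_incr a v j xy).
Qed.

(** One coordinate with v_i <> 0 is unbounded along the line, while the other
    terms can only grow. *)
Lemma dskew_sum_ge0 a v : v != 0 -> exists s, 0 <= dskew_sum q tau v (a + s *: v).
Proof.
move=> /rV0Pn[i vi].
pose C := \sum_(j < d | j != i) v 0 j * dskewpow q tau (a 0 j).
have led : {mono dskewpow q tau : x y / x <= y}.
  by apply: le_mono => x y; rewrite ltr_dskewpow.
suff [s s0 sC] : exists2 s, 0 <= s & - C <= v 0 i * dskewpow q tau (a 0 i + s * v 0 i).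
  exists s; rewrite /dskew_sum (bigD1 i)//= !mxE -[leLHS](subrr C) addrC lerD//.
  apply: ler_sum => j _; move: s0; rewrite le_eqVlt => /orP[/eqP <-|s0].
    by rewrite scale0r addr0.
  have /leifP := dskew_sum_term_incr a v j s0; rewrite scale0r addr0.
  by case: ifP => [_ /eqP ->//|_ /ltW].
have [vn|vp|/eqP] := ltgtP (v 0 i) 0; last by rewrite (negbTE vi).
- have [x xC] := dskewpow_unbounded_below q1 tau0 (- C / v 0 i).
  exists (Num.max 0 ((x - a 0 i) / v 0 i)); first by rewrite le_max lexx.
  rewrite -ler_ndivlMl// [leRHS]mulrC (le_trans _ xC)// led.
  rewrite -lerBrDl -ler_ndivrMr// le_max lexx orbT//.
- have [x xC] := dskewpow_unbounded q1 tau0 (- C / v 0 i).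
  exists (Num.max 0 ((x - a 0 i) / v 0 i)); first by rewrite le_max lexx.
  rewrite -ler_pdivrMl// [leLHS]mulrC (le_trans xC)// led.
  by rewrite -lerBlDl -ler_pdivrMr// le_max lexx orbT.
Qed.

Lemma dskew_sum_zero a v : v != 0 -> exists s, dskew_sum q tau v (a + s *: v) = 0.
Proof.
move=> v0; have [s2 g2] := dskew_sum_ge0 a v0.
have [s1 g1] : exists s, dskew_sum q tau v (a + s *: v) <= 0.
  have [|s gs] := @dskew_sum_ge0 a (- v); first by rewrite oppr_eq0.
  exists (- s); rewrite -oppr_ge0 (le_trans gs)// le_eqVlt; apply/orP; left; apply/eqP.
  by rewrite /dskew_sum -sumrN; apply: eq_bigr => i _; rewrite !mxE mulrN !mulNr.
have ge_min_l (x y : R) : x <= 0 -> Num.min x y <= 0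
  by move=> x0; rewrite ge_min x0.
have le_max_r (x y : R) : 0 <= y -> 0 <= Num.max x y
  by move=> y0; rewrite le_max y0 orbT.
have leg := le_mono (fun x y h => etrans (ltr_dskew_sum a v0 x y) h).
have s12 : s1 <= s2 by rewrite -leg (le_trans g1 g2).
have [|s] := @IVT _ _ s1 s2 0 s12 (continuous_subspaceT (@continuous_dskew_sum a v)).
  by apply/andP; split; [exact: (ge_min_l _ _ g1)|exact: (le_max_r _ _ g2)].
by move=> _ ?; exists s.
Qed.

(** The restriction of skew_sum to a line with nonzero direction is strictly
    convex, continuously differentiable and has a minimum m. *)
Lemma integral_line a v : v != 0 ->
  exists m, [/\ forall s, m <= skew_sum q tau (a + s *: v),
    exists s, skew_sum q tau (a + s *: v) = m &
    forall r, (\int[mu]_s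
      (if skew_sum q tau (a + s *: v) <= r
       then `|dskew_sum q tau v (a + s *: v)| else 0)%:E
     = (2 * Num.max (r - m) 0)%:E)%E].
Proof.
move=> v0; have [s0 gs0] := dskew_sum_zero a v0.
exists (skew_sum q tau (a + s0 *: v)); split.
- move=> s; exact: (convex_line_min (is_derive_skew_sum a v) (ltr_dskew_sum a v0) gs0).
- by exists s0.
- move=> r; exact: (integral_convex_line (is_derive_skew_sum a v)
    (@continuous_dskew_sum a v) (ltr_dskew_sum a v0) gs0).
Qed.

End line.

(** * Layer integrals *)

Lemma measurable_if_le d0 (T : measurableType d0) (f g : T -> R) (r : R) :
  measurable_fun setT f -> measurable_fun setT g ->
  measurable_fun setT (fun x => if f x <= r then g x else 0).
Proof.
move=> mf mg; apply: measurable_fun_ifT => //.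
exact: measurable_fun_ler.
Qed.

Lemma integral_if d0 (T : measurableType d0) (m : {measure set T -> \bar R})
  (P : T -> bool) : measurable [set x | P x] ->
  (\int[m]_x (if P x then 1 else 0 : R)%:E = m [set x | P x])%E.
Proof.
move=> mP; rewrite -[X in _ = m X]setIT -integral_indic// ; apply: eq_integral => x _.
rewrite indicE; congr (_%:E); have [xP|xP] := boolP (P x).
  by rewrite mem_set.
by rewrite memNset//; exact/negP.
Qed.

Lemma integral_in_itv (i : interval R) :
  (\int[mu]_r (if r \in i then 1 else 0 : R)%:E = mu [set` i])%E.
Proof. exact: (@integral_if _ RM mu (fun r => r \in i) (measurable_itv i)). Qed.

Section layer_mass.
Variables (q : R) (n : nat).
Hypothesis q1 : 1 < q.

(** The volume of the shadow of {skew_sum <= r} relative to that of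
    {skew_sum <= 1}, by homogeneity of degree q in dimension n. *)
Definition layer_weight (r : R) : R :=
  if (0 < r) && (r <= 1) then r `^ (n%:R / q) else 0.
(** The integral of r^(n/q) over the unit interval, that is q / (n + q).  Only
    its positivity matters: the constant appears in all volumes and cancels. *)
Definition layer_mass : R := fine (\int[mu]_r (layer_weight r)%:E)%E.

Lemma layer_weight_ge0 r : 0 <= layer_weight r.
Proof. by rewrite /layer_weight; case: ifP => // _; exact: powR_ge0. Qed.

Lemma measurable_in_itv (i : interval R) :
  measurable_fun setT (fun r : RM => r \in i).
Proof.
apply: (measurable_fun_bool true); rewrite setTI.
exact: (measurable_itv i).
Qed.

Lemma measurable_layer_weight : measurable_fun setT (layer_weight : RM -> R).
Proof.
have mc (c : R) : measurable_fun setT (fun r : RM => c) by exact: measurable_cst.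
have mi : measurable_fun setT (fun r : RM => r : R). exact: measurable_id.
apply: measurable_fun_ifT => //.
apply: (@measurable_and _ _ _ (fun r : RM => 0 < r) (fun r : RM => r <= 1)).
  exact: (measurable_fun_ltr (mc 0) mi).
exact: (measurable_fun_ler mi (mc 1)).
Qed.

Lemma layer_massE : (\int[mu]_r (layer_weight r)%:E = layer_mass%:E)%E.
Proof.
rewrite /layer_mass fineK// ge0_fin_numE; last first.
  by apply: integral_ge0 => r _; rewrite lee_fin layer_weight_ge0.
apply: (@le_lt_trans _ _ (\int[mu]_r (if r \in `]0, 1] then 1 else 0 : R)%:E)%E).
  apply: ge0_le_integral => //.
  - by move=> r _; rewrite lee_fin layer_weight_ge0.
  - by apply/measurable_EFinP; exact: measurable_layer_weight.
  - apply/measurable_EFinP; apply: measurable_fun_ifT => //.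
    exact: measurable_in_itv.
  - move=> r _; rewrite lee_fin /layer_weight in_itv/=.
    case: ifP => // /andP[r0 r1].
    rewrite -[leRHS](powRr0 r) ger_powR ?r0//.
    by apply: divr_ge0 => //; exact: (ltW (lt_trans ltr01 q1)).
rewrite integral_in_itv.
by rewrite lebesgue_measure_itv/= lte_fin ltr01 -EFinB ltry.
Qed.

Lemma layer_mass_gt0 : 0 < layer_mass.
Proof.
rewrite -lte_fin -layer_massE.
pose c : R := 2^-1 `^ (n%:R / q).
apply: (@lt_le_trans _ _
    (c%:E * \int[mu]_r (if r \in `]2^-1, 1] then 1 else 0 : R)%:E)%E).
  rewrite integral_in_itv.
  rewrite lebesgue_measure_itv/= lte_fin ifT; last lra.
  rewrite -EFinB -EFinM lte_fin mulr_gt0 ?powR_gt0//; lra.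
rewrite -ge0_integralZl//; last 3 first.
- by apply/measurable_EFinP; apply: measurable_fun_ifT => //; exact: measurable_in_itv.
- by move=> r _; rewrite lee_fin; case: ifP.
- by rewrite lee_fin powR_ge0.
apply: ge0_le_integral => //.
- by move=> r _; rewrite mule_ge0 ?lee_fin ?powR_ge0//; case: ifP.
- apply/measurable_EFinP; apply: measurable_funM => //.
  by apply: measurable_fun_ifT => //; exact: measurable_in_itv.
- by apply/measurable_EFinP; exact: measurable_layer_weight.
- move=> r _; rewrite -EFinM lee_fin in_itv/=.
  case: ifP => [/andP[r0 r1]|_]; last by rewrite mulr0 layer_weight_ge0.
  rewrite mulr1 /layer_weight r1 andbT ifT; last lra.
  apply: ge0_ler_powR; rewrite ?nnegrE; try lra.
  by apply: divr_ge0 => //; exact: (ltW (lt_trans ltr01 q1)).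
Qed.

End layer_mass.

(** * The volume of a shadow as a flux *)

Section shadow.
Variables (q tau : R) (n : nat).
Hypotheses (q1 : 1 < q) (tau0 : 0 < tau).
Variables (v : 'rV[R]_n.+1) (U : 'M[R]_(n, n.+1)).
Hypotheses (v1 : dotr v v = 1) (Uv : perp_basis v U).

Let q0 : 0 < q. Proof. by apply: lt_trans q1. Qed.

(** Integrated over the space with r = 1, this is the integral over the unit
    ball of skew_sum of the absolute derivative in the direction v; by the
    coarea formula it is a multiple of the flux of v through the boundary,
    hence of the volume of the shadow counted twice. *)
Definition flux_density (r : R) (x : tupleR n.+1) : R :=
  if skew_sum q tau (rv x) <= r then `|dskew_sum q tau v (rv x)| else 0.

(** The coordinates in the frame U of the projection of the unit ball of
    skew_sum along v. *)
Definition shadow : set (tupleR n) :=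
  [set y | exists s, skew_sum q tau (rv y *m U + s *: v) <= 1].

Lemma measurable_skew_sum d :
  measurable_fun setT (fun x : tupleR d => skew_sum q tau (rv x)).
Proof.
apply: measurable_sum => i.
apply: (measurableT_comp (@measurable_skewpow q tau q1)); exact: measurable_row_entry.
Qed.

Lemma measurable_flux_density r : measurable_fun setT (flux_density r).
Proof.
apply: measurable_if_le; first exact: measurable_skew_sum.
apply: measurableT_comp => //; apply: measurable_sum => i.
apply: measurable_funM => //.
apply: (measurableT_comp (@measurable_dskewpow q tau q1)); exact: measurable_row_entry.
Qed.

Lemma skew_sum_homo d r (x : 'rV[R]_d) : 0 <= r ->
  skew_sum q tau (r *: x) = r `^ q * skew_sum q tau x.
Proof.
move=> r0; rewrite /skew_sum mulr_sumr; apply: eq_bigr => i _.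
by rewrite mxE skewpow_homo.
Qed.

Lemma skew_sum_ge0 d (x : 'rV[R]_d) : 0 <= skew_sum q tau x.
Proof. by apply: sumr_ge0 => i _; exact: skewpow_ge0. Qed.

Lemma direction_neq0 : v != 0.
Proof.
apply/eqP => v0; move: v1; rewrite v0 /dotr big1 => [/esym/eqP|i _];
  last by rewrite mxE mul0r.
by rewrite oner_eq0.
Qed.

(** m y is the minimum of skew_sum on the line over y; the set {m <= r} is the
    shadow of {skew_sum <= r}. *)
Definition is_min_value (m : tupleR n -> R) := forall y : tupleR n,
  [/\ forall s, m y <= skew_sum q tau (rv y *m U + s *: v),
      exists s, skew_sum q tau (rv y *m U + s *: v) = m y &
      forall r, (\int[mu]_s (flux_density r (tuple_of_row (rv y *m U + s *: v)))%:E
       = (2 * Num.max (r - m y) 0)%:E)%E].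

Lemma min_value_ex : exists m, is_min_value m.
Proof.
suff /choice[m mP] : forall y : tupleR n, exists m,
    [/\ forall s, m <= skew_sum q tau (rv y *m U + s *: v),
      exists s, skew_sum q tau (rv y *m U + s *: v) = m &
      forall r, (\int[mu]_s (flux_density r (tuple_of_row (rv y *m U + s *: v)))%:E
       = (2 * Num.max (r - m) 0)%:E)%E] by exists m.
move=> y; have [m [m1 m2 m3]] := integral_line q1 tau0 (rv y *m U) direction_neq0.
exists m; split; [exact: m1|exact: m2|move=> r].
rewrite -m3; apply: eq_integral => s _.
by rewrite /flux_density tuple_of_rowK.
Qed.

Section min_value.
Variable m : tupleR n -> R.
Hypothesis mP : is_min_value m.

Let m_leP r y : m y <= r <-> exists s, skew_sum q tau (rv y *m U + s *: v) <= r.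
Proof.
have [m1 [s ms] _] := mP y; split => [mr|[t /(le_trans (m1 t))//]].
by exists s; rewrite ms.
Qed.

Let m_ge0 y : 0 <= m y.
Proof. by have [_ [s <-] _] := mP y; exact: skew_sum_ge0. Qed.

Let shadowE : shadow = [set y | m y <= 1].
Proof. by apply/seteqP; split => y /m_leP. Qed.

Let measurable_m : measurable_fun setT (m : tupleR n -> RM).
Proof.
apply: (measurability _ (RGenInftyO.measurableE R)) => _ [_ [r ->] <-].
rewrite setTI.
(* Measurability of m comes from the theorem of Fubini: r - m y is positive
   exactly when the line integral of flux_density at level r is. *)
pose H (y : tupleR n) :=
  (\int[mu]_s (flux_density r (tuple_of_row (rv y *m U + s *: v)))%:E)%E.
have mH : measurable_fun setT H.
  apply: (@measurable_fun_fubini_tonelli_G _ _ RM (tupleR n) R mu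
    (fun z => (flux_density r (tuple_of_row (rv z.2 *m U + z.1 *: v)))%:E)).
    apply/measurable_EFinP.
    apply: (measurableT_comp (measurable_flux_density r)).
    exact: measurable_frame.
  by move=> z; rewrite lee_fin /flux_density; case: ifP.
rewrite (_ : _ @^-1` _ = H @^-1` [set z | 0 < z]%E).
  apply: measurable_fun_preimage => //.
  rewrite (_ : [set z | _] = `]0%E, +oo[%classic); first exact: emeasurable_itv.
  by apply/seteqP; split => z /=; rewrite in_itv/= andbT.
apply/seteqP; split => y /=; rewrite in_itv/= /H; have [_ _ ->] := mP y;
  by rewrite lte_fin pmulr_rgt0// lt_max ltxx orbF subr_gt0.
Qed.

Let measurable_shadow : measurable shadow.
Proof.
rewrite shadowE (_ : [set y | _] = m @^-1` `]-oo, 1%R]).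
  by apply: measurable_fun_preimage => //; exact: measurable_itv.
by apply/seteqP; split => y /=; rewrite in_itv.
Qed.

Let lam_m r : 0 < r ->
  lam n [set y | m y <= r] = ((r `^ (n%:R / q))%:E * lam n shadow)%E.
Proof.
move=> r0.
(* Dilating by t maps the shadow at level r to the shadow at level 1. *)
pose t := r `^ (- q^-1).
have t0 : 0 < t by rewrite powR_gt0.
have tq : t `^ q = r^-1.
  by rewrite /t -powRrM mulNr mulVf ?gt_eqF// powR_inv1// ltW.
have -> : [set y | m y <= r] = tmulmx (diag_mx (const_mx t)) @^-1` shadow.
  apply/seteqP; split => y; rewrite /shadow /tmulmx /=;
    rewrite m_leP tuple_of_rowK diag_const_mx mul_mx_scalar.
    move=> [s ys]; exists (t * s).
    rewrite -scalemxAl -scalerA -scalerDr skew_sum_homo ?(ltW t0)// tq.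
    by rewrite ler_pdivrMl// mulr1.
  move=> [s]; rewrite -scalemxAl => ys; exists (t^-1 * s).
  move: ys; rewrite (_ : t *: _ + _ = t *: (rv y *m U + (t^-1 * s) *: v)).
    by rewrite skew_sum_homo ?(ltW t0)// tq ler_pdivrMl// mulr1.
  by rewrite scalerDr scalerA mulrA divff ?gt_eqF// mul1r.
have tn0 i : (const_mx t : 'rV[R]_n) 0 i != 0 by rewrite mxE gt_eqF.
apply: (etrans (@lebesgue_tuple_diag n (const_mx t) shadow tn0 measurable_shadow)).
congr (_%:E * _)%E.
under eq_bigr do rewrite mxE gtr0_norm//.
rewrite prodr_const card_ord.
rewrite /t powRN invrK -powR_mulrn ?powR_ge0//.
by rewrite -powRrM mulrC.
Qed.

Let shadow_formula :
  (\int[lam n.+1]_x (flux_density 1 x)%:E = (2 * layer_mass q n)%:E * lam n shadow)%E.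
Proof.
rewrite (ge0_integral_frame v1 Uv); last 2 first.
- by apply/measurable_EFinP; exact: measurable_flux_density.
- by move=> x; rewrite lee_fin /flux_density; case: ifP.
(* Layer cake: (1 - m y)_+ is the length of the set of r in ]0, 1] with m y <= r. *)
pose F (z : RM * tupleR n) : R :=
  if (0 < z.1) && (z.1 <= 1) && (m z.2 <= z.1) then 1 else 0.
have mF : measurable_fun setT (EFin \o F).
  apply/measurable_EFinP; apply: measurable_fun_ifT => //.
  have mm : measurable_fun setT (fun z : RM * tupleR n => m z.2).
    by apply: (measurableT_comp measurable_m); exact: measurable_snd.
  have m1 : measurable_fun setT (fun z : RM * tupleR n => z.1 : R).
    exact: measurable_fst.
  have mc (c : R) : measurable_fun setT (fun z : RM * tupleR n => c).
    exact: measurable_cst.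
  apply: measurable_and; last exact: (measurable_fun_ler mm m1).
  apply: measurable_and; [exact: (measurable_fun_ltr (mc 0) m1)|].
  exact: (measurable_fun_ler m1 (mc 1)).
have F0 z : (0 <= (EFin \o F) z)%E by rewrite lee_fin /F; case: ifP.
transitivity (2%:E * \int[lam n]_y \int[mu]_r (F (r, y))%:E)%E.
  rewrite -ge0_integralZl//; last 2 first.
  - exact: (measurable_fun_fubini_tonelli_G (EFin \o F)).
  - by move=> y _; apply: integral_ge0 => r _; exact: (F0 (r, y)).
  apply: eq_integral => y _; have [_ _ ->] := mP y.
  rewrite EFinM; congr (_ * _)%E.
  (* The lower end of the layers is excluded only when m y = 0, as r > 0. *)
  pose i : interval R :=
    Interval (if 0 < m y then BLeft (m y) else BRight 0) (BRight 1).
  transitivity (\int[mu]_r (if r \in i then 1 else 0 : R)%:E)%E; last first.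
    apply: eq_integral => r _; congr (_%:E); rewrite /F/= /i.
    have := m_ge0 y; rewrite le_eqVlt => /orP[/eqP <-|my0]; rewrite ?ltxx ?my0 in_itv/=.
      by case: ltP => //= r0; rewrite (ltW r0) andbT.
    have [myr|myr] := leP (m y) r; last by rewrite andbF.
    by rewrite (lt_le_trans my0 myr) andbT.
  rewrite integral_in_itv.
  rewrite lebesgue_measure_itv /i.
  have := m_ge0 y; rewrite le_eqVlt => /orP[/eqP <-|my0]; rewrite ?ltxx ?my0/= lte_fin.
    by rewrite ltr01 -EFinB max_l ?subr0// ler01.
  have [m1|m1] := ltP (m y) 1; last by rewrite max_r// subr_le0.
  by rewrite -EFinB max_l// subr_ge0 ltW.
rewrite -(fubini_tonelli (EFin \o F))//.
rewrite EFinM -muleA; congr (_ * _)%E.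
rewrite -layer_massE// -ge0_integralZr//; last 2 first.
- by apply/measurable_EFinP; exact: measurable_layer_weight.
- by move=> r _; rewrite lee_fin layer_weight_ge0.
apply: eq_integral => r _; rewrite /layer_weight.
under eq_integral do rewrite /F/=.
case: ifPn => [/andP[r0 r1]|_].
  rewrite -lam_m// integral_if//.
  rewrite (_ : [set y | _] = m @^-1` `]-oo, r]); first exact: measurable_fun_preimage.
  by apply/seteqP; split => y /=; rewrite in_itv.
by rewrite mul0e integral0.
Qed.

Lemma min_value_shadow : measurable shadow /\
  (\int[lam n.+1]_x (flux_density 1 x)%:E = (2 * layer_mass q n)%:E * lam n shadow)%E.
Proof. by split; [exact: measurable_shadow|exact: shadow_formula]. Qed.

End min_value.

Lemma measurable_shadow : measurable shadow.
Proof. by have [m /min_value_shadow[]] := min_value_ex. Qed.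

(** Integrate along the lines parallel to v, where the variation of skew_sum
    is 2 (1 - m y)_+, and then over y, layer by layer. *)
Lemma shadow_formula :
  (\int[lam n.+1]_x (flux_density 1 x)%:E = (2 * layer_mass q n)%:E * lam n shadow)%E.
Proof. by have [m /min_value_shadow[]] := min_value_ex. Qed.

End shadow.

(** * Decomposition into orthants *)

Section orthants.
Variable d : nat.

Definition in_orthant (J : {set 'I_d}) (x : tupleR d) : bool :=
  [forall i, if i \in J then tnth x i < 0 else 0 < tnth x i].

Lemma measurable_in_orthant J : measurable [set x | in_orthant J x].
Proof.
rewrite (_ : [set x | _] = [set x : tupleR d | forall i,
    (if i \in J then `]-oo, 0[%classic else `]0, +oo[%classic : set RM) (tnth x i)]).
  apply: (@measurable_box d (fun i => if i \in J then `]-oo, 0[%classic else `]0,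
    +oo[%classic)) => i.
  by case: ifP => _; exact: measurable_itv.
apply/seteqP; split => x /= => [/forallP h i|h].
  by have := h i; case: ifP => _; rewrite /= in_itv/= ?andbT.
by apply/forallP => i; have := h i; case: ifP => _; rewrite /= in_itv/= ?andbT.
Qed.

Lemma measurable_in_orthant_fun J : measurable_fun setT (fun x => in_orthant J x).
Proof.
by apply: (measurable_fun_bool true); rewrite setTI; exact: measurable_in_orthant.
Qed.

(** The coordinate hyperplanes are null, so almost every point lies in exactly
    one open orthant. *)
Lemma ae_nonzero : {ae lam d, forall x : tupleR d, forall i, tnth x i != 0}.
Proof.
have h (k : nat) : {ae lam d, forall x : tupleR d, forall i : 'I_d,
    i = k :> nat -> tnth x i != 0}.
  have [kd|kd] := ltnP k d; last first.
    by apply: aeW => x i ik; have := ltn_ord i; rewrite ik ltnNge kd.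
  pose A (i : 'I_d) : set RM := if i == Ordinal kd then [set 0] else setT.
  have mA i : measurable (A i) by rewrite /A; case: ifP.
  exists [set t : tupleR d | forall i, A i (tnth t i)]; split.
  - exact: measurable_box.
  - rewrite lebesgue_tuple_box// (bigD1 (Ordinal kd))//= {1}/A eqxx.
    by rewrite lebesgue_measure_set1 mul0e.
  - move=> x /= /existsNP[i /not_implyP[ik /negP]]; rewrite negbK => /eqP xi j.
    rewrite /A; case: eqP => // ->.
    by rewrite (_ : Ordinal kd = i)//; apply: val_inj; rewrite /= ik.
by apply: filterS (ae_foralln h) => x hx i; exact: (hx i).
Qed.

Lemma sum_in_orthant (x : tupleR d) (c : R) : (forall i, tnth x i != 0) ->
  \sum_(J : {set 'I_d}) (if in_orthant J x then c else 0) = c.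
Proof.
move=> x0; pose J0 := [set i | tnth x i < 0]%SET.
have e J : in_orthant J x = (J == J0).
  apply/idP/eqP => [/forallP h|->].
    apply/setP => i; rewrite inE; have := h i.
    by case: ifP => _ hi; rewrite ?hi// ltNge (ltW hi).
  by apply/forallP => i; rewrite inE; case: ltgtP (x0 i).
under eq_bigr do rewrite e.
by rewrite -big_mkcond big_pred1_eq.
Qed.

(** The diagonal map with this diagonal sends the positive orthant to the
    orthant with negative coordinates J, stretching these coordinates by tau;
    it turns the skewed powers back into the plain ones. *)
Definition flip_row (tau : R) (J : {set 'I_d}) : 'rV[R]_d :=
  \row_i (if i \in J then - tau else 1).

Lemma in_orthant_flip tau J (x : tupleR d) : 0 < tau ->
  in_orthant J (tmulmx (diag_mx (flip_row tau J)) x) = in_orthant finset.set0 x.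
Proof.
move=> tau0; apply/eq_forallb => i.
rewrite /tmulmx tnth_mktuple mul_mx_diag !mxE finset.in_set0.
case: ifP => iJ; rewrite iJ; last by rewrite mulr1.
by rewrite mulrN oppr_lt0 pmulr_lgt0.
Qed.

Lemma integral_orthants tau (h : tupleR d -> R) : 0 < tau ->
  measurable_fun setT h -> (forall x, 0 <= h x) ->
  (\int[lam d]_x (h x)%:E =
   \sum_(J : {set 'I_d}) (tau ^+ #|J|)%:E * \int[lam d]_x
     (if in_orthant finset.set0 x
      then h (tmulmx (diag_mx (flip_row tau J)) x) else 0)%:E)%E.
Proof.
move=> tau0 mh h0.
pose g J (x : tupleR d) : R := if in_orthant J x then h x else 0.
have mg J : measurable_fun setT (g J).
  by apply: measurable_fun_ifT => //; exact: measurable_in_orthant_fun.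
have g0 J x : 0 <= g J x by rewrite /g; case: ifP.
transitivity (\int[lam d]_x (\sum_J (g J x)%:E))%E.
  apply: ge0_ae_eq_integral => //.
  - exact/measurable_EFinP.
  - by apply: emeasurable_sum => J; exact/measurable_EFinP.
  - by move=> x _; rewrite lee_fin.
  - by move=> x _; apply: sume_ge0 => J _; rewrite lee_fin.
  - apply: filterS ae_nonzero => x hx _.
    by rewrite sumEFin sum_in_orthant.
rewrite ge0_integral_sum//; last 2 first.
- by move=> J; exact/measurable_EFinP.
- by move=> J x _; rewrite lee_fin.
apply: eq_bigr => J _.
have fn0 i : flip_row tau J 0 i != 0.
  by rewrite mxE; case: ifP => _; rewrite ?oppr_eq0 ?gt_eqF.
have prodE : \prod_i `|flip_row tau J 0 i|^-1 = (tau ^+ #|J|)^-1.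
  rewrite prodfV -prodr_const [X in _ = X^-1]big_mkcond/=; congr (_^-1).
  apply: eq_bigr => i _; rewrite mxE; case: ifP => _; last by rewrite normr1.
  by rewrite normrN gtr0_norm.
have k0 : 0 <= (tau ^+ #|J|)^-1 by rewrite invr_ge0 exprn_ge0// ltW.
have mk A : measurable A -> lam d (tmulmx (diag_mx (flip_row tau J)) @^-1` A) =
    ((NngNum k0)%:num%:E * lam d A)%E.
  by move=> mA; rewrite /= -prodE; exact: lebesgue_tuple_diag.
have e := ge0_integral_scale_measure (measurable_tmulmx _) mk.
have {}e := e (fun x => (g J x)%:E) ltac:(exact/measurable_EFinP) ltac:(by move=> x;
  rewrite lee_fin).
rewrite [X in (_ = _ * X)%E](_ : _ =
  (\int[lam d]_x (g J (tmulmx (diag_mx (flip_row tau J)) x))%:E)%E).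
  rewrite e muleA -EFinM /= divff ?mul1e// gt_eqF// exprn_gt0//.
by apply: eq_integral => x _; rewrite /g in_orthant_flip.
Qed.

End orthants.

(** * The flux through one orthant *)

Section orthant_flux.
Variables (q : R) (d : nat).
Hypothesis q1 : 1 < q.
Implicit Types (w : 'rV[R]_d) (x : tupleR d).

(** The open positive orthant is used because it differs from the closed one by a
    null set. *)
Definition in_pos_ball x : bool :=
  in_orthant finset.set0 x && (\sum_i tnth x i `^ q <= 1).

(** The outer normal direction at a boundary point of the l_q ball in the positive
    orthant. *)
Definition conormal x : 'rV[R]_d := \row_i (tnth x i `^ (q - 1)).

Definition orthant_density w x : R :=
  if in_pos_ball x then `|dotr w (conormal x)| else 0.

(** Up to a constant factor, the absolute flux of w through the curved part of
    the boundary of the ball in the positive orthant.  It is an integral of norms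
    |<w, a>| over nonnegative vectors a, so every inequality between linear
    combinations of such norms that holds pointwise in a is inherited. *)
Definition orthant_flux w : R := fine (\int[lam d]_x (orthant_density w x)%:E)%E.

Lemma pos_orthantP x : reflect (forall i, 0 < tnth x i) (in_orthant finset.set0 x).
Proof.
by apply: (iffP forallP) => h i; have := h i; rewrite finset.in_set0.
Qed.

Lemma in_pos_ball_le1 x i : in_pos_ball x -> 0 < tnth x i <= 1.
Proof.
move=> /andP[/pos_orthantP x0 xb]; rewrite x0/= leNgt; apply/negP => x1.
move: xb; rewrite leNgt => /negP; apply; rewrite (bigD1 i)//=.
apply: (@lt_le_trans _ _ (tnth x i `^ q)); last first.
  by rewrite lerDl sumr_ge0// => j _; exact: powR_ge0.
have one_powR : (1 : R) `^ q = 1 by rewrite powR1.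
rewrite -[ltLHS]one_powR; apply: gt0_ltr_powR => //; last by rewrite nnegrE ltW.
  exact: lt_trans q1.
by rewrite nnegrE.
Qed.

Lemma conormal_bound x i : in_pos_ball x -> 0 <= conormal x 0 i <= 1.
Proof.
move=> /(in_pos_ball_le1 i)/andP[x0 x1]; rewrite mxE powR_ge0/=.
by rewrite -[leRHS](powRr0 (tnth x i)) ger_powR ?x0// subr_ge0 ltW.
Qed.

Lemma measurable_tnth_powR p i :
  measurable_fun setT (fun x : tupleR d => tnth x i `^ p).
Proof.
apply: (@measurableT_comp _ _ _ _ _ _ (fun y : R => y `^ p) _ (fun x : tupleR d =>
  tnth x i)).
  exact: measurable_powR.
exact: measurable_tnth.
Qed.

Lemma measurable_in_pos_ball : measurable_fun setT (fun x => in_pos_ball x).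
Proof.
apply: measurable_and; first exact: measurable_in_orthant_fun.
apply: measurable_fun_ler; last exact: measurable_cst.
apply: measurable_sum => i.
exact: measurable_tnth_powR.
Qed.

Lemma measurable_orthant_density w : measurable_fun setT (orthant_density w).
Proof.
apply: measurable_fun_ifT => //; first exact: measurable_in_pos_ball.
apply: measurableT_comp => //; apply: measurable_sum => i.
apply: measurable_funM => //; under eq_fun do rewrite mxE.
exact: measurable_tnth_powR.
Qed.

Lemma orthant_density_ge0 w x : 0 <= orthant_density w x.
Proof. by rewrite /orthant_density; case: ifP. Qed.

Lemma integrable_orthant_density w :
  (lam d).-integrable setT (fun x => (orthant_density w x)%:E).
Proof.
have mj : measurable_fun setT (fun x => (orthant_density w x)%:E).
  by apply/measurable_EFinP; exact: measurable_orthant_density.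
apply/integrableP; split => //.
pose C := \sum_i `|w 0 i|.
pose box x := [forall i, 0 <= tnth x i <= 1].
have boxE : [set x | box x] = [set x : tupleR d | forall i, 0 <= tnth x i <= 1].
  by apply/seteqP; split => x /forallP.
have mbox : measurable [set x | box x] by rewrite boxE; exact: measurable_itv_box.
apply: (@le_lt_trans _ _ (C%:E * \int[lam d]_x (if box x then 1 else 0 : R)%:E)%E).
  have C0 : 0 <= C by exact: sumr_ge0.
  have mb : measurable_fun setT (fun x : tupleR d => (if box x then 1 else 0 : R)).
    apply: measurable_fun_ifT => //.
    by apply: (measurable_fun_bool true); rewrite setTI.
  rewrite -ge0_integralZl//; last 2 first.
  - exact/measurable_EFinP.
  - by move=> x _; rewrite lee_fin; case: ifP.
  apply: ge0_le_integral => //.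
  - exact: measurableT_comp.
  - by apply/measurable_EFinP; exact: measurable_funM.
  - move=> x _; rewrite -EFinM abse_EFin lee_fin ger0_norm ?orthant_density_ge0//
    /orthant_density.
    case: ifP => [xb|_]; last by rewrite mulr_ge0//; case: ifP.
    rewrite ifT ?mulr1; last first.
      by apply/forallP => i; have /andP[/ltW -> ->] := in_pos_ball_le1 i xb.
    apply: (le_trans (ler_norm_sum _ _ _)); apply: ler_sum => i _.
    have /andP[p0 p1] := conormal_bound i xb.
    by rewrite normrM ler_piMr// ger0_norm.
have lb : lam d [set x | box x] = (\prod_(i < d) (1 - 0))%:E.
  by rewrite boxE; exact: (@lebesgue_tuple_itv d (fun=> 0) (fun=> 1) (fun=> ler01)).
have -> : (\int[lam d]_x (if box x then 1 else 0 : R)%:E =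
  (\prod_(i < d) (1 - 0))%:E)%E.
  exact: (etrans (integral_if _ mbox) lb).
by rewrite -EFinM ltry.
Qed.

Lemma orthant_fluxE w :
  (\int[lam d]_x (orthant_density w x)%:E = (orthant_flux w)%:E)%E.
Proof.
by rewrite /orthant_flux fineK//;
  exact: integrable_fin_num (integrable_orthant_density w).
Qed.

Lemma orthant_flux_ge0 w : 0 <= orthant_flux w.
Proof.
by rewrite -lee_fin -orthant_fluxE; apply: integral_ge0 => x _;
  rewrite lee_fin orthant_density_ge0.
Qed.

Implicit Types s : seq (R * 'rV[R]_d).

Lemma orthant_flux_sum s :
  (lam d).-integrable setT (fun x => (\sum_(p <- s) p.1 * orthant_density p.2 x)%:E) /\
  (\int[lam d]_x (\sum_(p <- s) p.1 * orthant_density p.2 x)%:E =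
   (\sum_(p <- s) p.1 * orthant_flux p.2)%:E)%E.
Proof.
elim: s => [|[c w] s [ih1 ih2]].
  have e : (fun x : tupleR d =>
      (\sum_(p <- [::] : seq (R * 'rV[R]_d)) p.1 * orthant_density p.2 x)%:E) = cst 0%E.
    by apply/funext => x; rewrite big_nil.
  by rewrite big_nil e; split; [exact: integrable0|exact: integral0].
have iw : (lam d).-integrable setT (fun x => (c%:E * (orthant_density w x)%:E)%E).
  by apply: integrableZl => //; exact: integrable_orthant_density.
have e x : (\sum_(p <- (c, w) :: s) p.1 * orthant_density p.2 x)%:E =
    (c%:E * (orthant_density w x)%:E +
      (\sum_(p <- s) p.1 * orthant_density p.2 x)%:E)%E.
  by rewrite big_cons EFinD EFinM.
split.
  rewrite (_ : (fun x => _) = (fun x =>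
    (c%:E * (orthant_density w x)%:E +
    (\sum_(p <- s) p.1 * orthant_density p.2 x)%:E)%E)).
    exact: integrableD.
  exact/funext.
rewrite (eq_integral (fun x =>
  (c%:E * (orthant_density w x)%:E +
  (\sum_(p <- s) p.1 * orthant_density p.2 x)%:E)%E)) => [|x _]; last exact: e.
rewrite integralD// ih2 integralZl//; last exact: integrable_orthant_density.
by rewrite orthant_fluxE big_cons EFinD EFinM.
Qed.

Lemma orthant_density_sum s x : in_pos_ball x ->
  \sum_(p <- s) p.1 * orthant_density p.2 x =
    \sum_(p <- s) p.1 * `|dotr p.2 (conormal x)|.
Proof. by move=> xb; apply: eq_bigr => p _; rewrite /orthant_density xb. Qed.

Lemma orthant_density_sum0 s x : ~~ in_pos_ball x ->
  \sum_(p <- s) p.1 * orthant_density p.2 x = 0.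
Proof.
by move=> xb; rewrite big1// => p _; rewrite /orthant_density (negbTE xb) mulr0.
Qed.

Lemma orthant_flux_le s s' :
  (forall a : 'rV[R]_d, (forall i, 0 <= a 0 i) ->
    \sum_(p <- s) p.1 * `|dotr p.2 a| <= \sum_(p <- s') p.1 * `|dotr p.2 a|) ->
  \sum_(p <- s) p.1 * orthant_flux p.2 <= \sum_(p <- s') p.1 * orthant_flux p.2.
Proof.
move=> h; have [i1 e1] := orthant_flux_sum s; have [i2 e2] := orthant_flux_sum s'.
rewrite -lee_fin -e1 -e2; apply: le_integral => // x _; rewrite lee_fin.
have [xb|xb] := boolP (in_pos_ball x); last by rewrite !orthant_density_sum0.
rewrite !orthant_density_sum//; apply: h => i.
by have /andP[] := conormal_bound i xb.
Qed.

Lemma orthant_flux_eq s s' :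
  (forall a : 'rV[R]_d, (forall i, 0 <= a 0 i) ->
    \sum_(p <- s) p.1 * `|dotr p.2 a| = \sum_(p <- s') p.1 * `|dotr p.2 a|) ->
  \sum_(p <- s) p.1 * orthant_flux p.2 = \sum_(p <- s') p.1 * orthant_flux p.2.
Proof.
by move=> h; apply/eqP; rewrite eq_le !orthant_flux_le// => a a0; rewrite h.
Qed.

(** The linear combinations are given as lists of pairs (coefficient, weight).
    A weak pointwise inequality that is strict on a nondegenerate box integrates
    to a strict one. *)
Lemma orthant_flux_lt s s' (lo hi : 'I_d -> R) :
  (forall a : 'rV[R]_d, (forall i, 0 <= a 0 i) ->
    \sum_(p <- s) p.1 * `|dotr p.2 a| <= \sum_(p <- s') p.1 * `|dotr p.2 a|) ->
  (forall i, lo i < hi i) ->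
  (forall x, (forall i, lo i <= tnth x i <= hi i) -> in_pos_ball x /\
    \sum_(p <- s) p.1 * `|dotr p.2 (conormal x)| <
      \sum_(p <- s') p.1 * `|dotr p.2 (conormal x)|) ->
  \sum_(p <- s) p.1 * orthant_flux p.2 < \sum_(p <- s') p.1 * orthant_flux p.2.
Proof.
move=> h lohi strict; rewrite lt_neqAle orthant_flux_le// andbT; apply/eqP => E.
have [i1 e1] := orthant_flux_sum s; have [i2 e2] := orthant_flux_sum s'.
pose D x := ((\sum_(p <- s') p.1 * orthant_density p.2 x)%:E -
  (\sum_(p <- s) p.1 * orthant_density p.2 x)%:E)%E.
have D0 x : (0 <= D x)%E.
  rewrite /D -EFinB lee_fin subr_ge0.
  have [xb|xb] := boolP (in_pos_ball x); last by rewrite !orthant_density_sum0.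
  rewrite !orthant_density_sum//; apply: h => i.
  by have /andP[] := conormal_bound i xb.
have iD : (lam d).-integrable setT D by exact: integrableB.
have : (\int[lam d]_x `|D x| = 0)%E.
  rewrite (eq_integral D) => [|x _]; last by rewrite gee0_abs.
  by rewrite integralB// e1 e2 E subee.
have mD : measurable_fun setT D by exact: measurable_int iD.
move=> /(ae_eq_integral_abs _ measurableT mD)[N [mN N0 DN]].
pose B := [set x : tupleR d | forall i, lo i <= tnth x i <= hi i].
have mB : measurable B by exact: measurable_itv_box.
have BN : B `<=` N.
  move=> x /strict[xb lt]; apply: DN => /= /(_ I).
  rewrite /D -EFinB => -[]; apply/eqP; rewrite gt_eqF// subr_gt0.
  by rewrite !orthant_density_sum.
have : (lam d B <= lam d N)%E by apply: le_measure; rewrite ?inE.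
rewrite N0 lebesgue_tuple_itv => [|i]; last exact/ltW.
by rewrite lee_fin leNgt prodr_gt0// => i _; rewrite subr_gt0.
Qed.

End orthant_flux.

(** * The orthant flux as a function of the weight *)

Section orthant_flux_theory.
Variables (q : R) (d : nat).
Hypothesis q1 : 1 < q.
Implicit Types (w : 'rV[R]_d).
Notation J := (@orthant_flux q d).
Notation e i := (delta_mx 0 i : 'rV[R]_d).

Lemma dotr_delta i (a : 'rV[R]_d) : dotr (e i) a = a 0 i.
Proof.
rewrite /dotr (bigD1 i)//= big1 => [|j ji]; first by rewrite mxE !eqxx mul1r addr0.
by rewrite mxE (negbTE ji) andbF mul0r.
Qed.

Lemma dotrDl w w' (a : 'rV[R]_d) : dotr (w + w') a = dotr w a + dotr w' a.
Proof. by rewrite /dotr -big_split/=; apply: eq_bigr => i _; rewrite mxE mulrDl. Qed.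

Lemma dotrZl c w (a : 'rV[R]_d) : dotr (c *: w) a = c * dotr w a.
Proof. by rewrite /dotr mulr_sumr; apply: eq_bigr => i _; rewrite mxE mulrA. Qed.

Lemma dotr_suml (I : Type) (r : seq I) (w : I -> 'rV[R]_d) (a : 'rV[R]_d) :
  dotr (\sum_(k <- r) w k) a = \sum_(k <- r) dotr (w k) a.
Proof.
rewrite /dotr exchange_big; apply: eq_bigr => i _ /=.
by rewrite summxE mulr_suml.
Qed.

Lemma orthant_flux_lip w w' : J w <= J w' + \sum_i `|w 0 i - w' 0 i| * J (e i).
Proof.
have := orthant_flux_le q1 (s := [:: (1, w)])
  (s' := (1, w') :: [seq (`|w 0 i - w' 0 i|, e i) | i <- index_enum 'I_d]).
rewrite !big_cons big_nil big_map/= addr0 !mul1r; apply => a a0.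
rewrite !big_cons big_nil big_map/= addr0 !mul1r.
rewrite -[w in leLHS](addrNK w') addrC dotrDl.
apply: le_trans (ler_normD _ _) _; rewrite lerD2l.
apply: le_trans (ler_norm_sum _ _ _) _; apply: ler_sum => i _.
by rewrite normrM dotr_delta !mxE.
Qed.

Lemma orthant_flux_homog c w : J (c *: w) = `|c| * J w.
Proof.
have := orthant_flux_eq q1 (s := [:: (1, c *: w)]) (s' := [:: (`|c|, w)]).
rewrite !big_seq1/= mul1r; apply => a a0.
by rewrite !big_seq1/= mul1r dotrZl normrM.
Qed.

(** For nonnegative weights the norm in the integrand is additive. *)
Lemma orthant_flux_ge0_weight w : (forall i, 0 <= w 0 i) ->
  J w = \sum_i w 0 i * J (e i).
Proof.
move=> w0; have := orthant_flux_eq q1 (s := [:: (1, w)])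
  (s' := [seq (w 0 i, e i) | i <- index_enum 'I_d]).
rewrite big_seq1 big_map/= mul1r; apply => a a0.
rewrite big_seq1 big_map/= mul1r ger0_norm; last first.
  by apply: sumr_ge0 => i _; exact: mulr_ge0.
by apply: eq_bigr => i _; rewrite dotr_delta ger0_norm.
Qed.

Lemma orthant_flux_ub w : J w <= \sum_i `|w 0 i| * J (e i).
Proof.
have := orthant_flux_lip w 0; rewrite -(scale0r w) orthant_flux_homog normr0 mul0r
  add0r.
by under eq_bigr do rewrite scale0r mxE subr0.
Qed.

Lemma orthant_flux_triangle (I : Type) (r : seq I) (w : I -> 'rV[R]_d) :
  J (\sum_(k <- r) w k) <= \sum_(k <- r) J (w k).
Proof.
have := orthant_flux_le q1 (s := [:: (1, \sum_(k <- r) w k)])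
  (s' := [seq (1, w k) | k <- r]).
rewrite big_seq1 big_map/= mul1r; under [leRHS]eq_bigr do rewrite mul1r.
apply => a a0; rewrite big_seq1 big_map/= mul1r dotr_suml.
by apply: le_trans (ler_norm_sum _ _ _) _; apply: ler_sum => k _; rewrite mul1r.
Qed.

(** The weight seen from the positive orthant after the change of variables
    given by flip_row: the derivative of skewpow on the negative side carries
    the factor -1 / tau. *)
Definition flip_weight (tau : R) (I : {set 'I_d}) w : 'rV[R]_d :=
  \row_i (if i \in I then - (tau^-1 * w 0 i) else w 0 i).

End orthant_flux_theory.

Lemma perm_mx_orthogonal d (s : 'S_d) : perm_mx s *m (perm_mx s)^T = 1%:M :> 'M[R]_d.
Proof. by rewrite tr_perm_mx -perm_mxM mulgV perm_mx1. Qed.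

Lemma orthant_flux_perm (q : R) (d : nat) (s : 'S_d) (w : 'rV[R]_d) : 1 < q ->
  orthant_flux q (col_perm s w) = orthant_flux q w.
Proof.
move=> q1; apply: EFin_inj; rewrite -!orthant_fluxE//.
have tE (x : tupleR d) i : tnth (tmulmx (perm_mx s) x) i = tnth x ((s^-1)%g i).
  rewrite /tmulmx tnth_mktuple -[s]invgK -col_permE mxE invgK.
  by rewrite mxE.
rewrite -[RHS](ge0_integral_orthogonal (perm_mx_orthogonal s)); last 2 first.
- by apply/measurable_EFinP; exact: measurable_orthant_density.
- by move=> x; rewrite lee_fin orthant_density_ge0.
apply: eq_integral => x _; congr EFin; rewrite /orthant_density.
have -> : in_pos_ball q (tmulmx (perm_mx s) x) = in_pos_ball q x.
  congr andb.
    apply/pos_orthantP/pos_orthantP => h i; last by rewrite tE.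
    by have := h (s i); rewrite tE permK.
  congr (_ <= _); rewrite [RHS](reindex_inj (@perm_inj _ s^-1%g)).
  by apply: eq_bigr => i _; rewrite tE.
case: ifP => // _; congr (`|_|); rewrite /dotr [RHS](reindex_inj (@perm_inj _ s)).
by apply: eq_bigr => i _; rewrite !mxE tE permK.
Qed.

(** * The total flux as a signed sum of orthant fluxes *)

Section flux.
Variables (q tau : R) (n : nat).
Hypotheses (q1 : 1 < q) (tau0 : 0 < tau).
Variable (v : 'rV[R]_n.+1).

(** On each orthant, the change of variables to the positive orthant has
    Jacobian tau^#|I| and turns dskew_sum into q times a scalar product with
    conormal. *)
Lemma flux_orthants : (\int[lam n.+1]_x (flux_density q tau v 1 x)%:E =
  (q * \sum_(I : {set 'I_n.+1})
    tau ^+ #|I| * orthant_flux q (flip_weight tau I v))%:E)%E.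
Proof.
rewrite (integral_orthants tau0); last 2 first.
- exact: measurable_flux_density.
- by move=> x; rewrite /flux_density; case: ifP.
rewrite mulr_sumr -sumEFin; apply: eq_bigr => I _.
rewrite mulrCA EFinM; congr (_ * _)%E.
rewrite EFinM -orthant_fluxE// -ge0_integralZl//; last 3 first.
- by apply/measurable_EFinP; exact: measurable_orthant_density.
- by move=> x _; rewrite lee_fin orthant_density_ge0.
- by rewrite lee_fin ltW// (lt_trans ltr01).
apply: eq_integral => x _; rewrite -EFinM; congr EFin.
rewrite /orthant_density /in_pos_ball; case: ifP => [/pos_orthantP x0|_];
  last by rewrite mulr0.
have xE i : (rv (tmulmx (diag_mx (flip_row tau I)) x)) 0 i =
    if i \in I then - tau * tnth x i else tnth x i.
  rewrite /tmulmx tuple_of_rowK mul_mx_diag !mxE.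
  by case: ifP => iI; rewrite ?mulr1// mulrC.
rewrite /flux_density.
have -> : skew_sum q tau (rv (tmulmx (diag_mx (flip_row tau I)) x)) =
  \sum_i tnth x i `^ q.
  apply: eq_bigr => i _; rewrite xE; case: ifP => _.
    by rewrite skewpow_le0_arg// ltW.
  by rewrite skewpow_ge0_arg// ltW.
case: ifP => _; last by rewrite mulr0.
have q0 : 0 <= q by rewrite ltW// (lt_trans ltr01).
rewrite -[X in _ = X * _](ger0_norm q0) -normrM; congr (`|_|).
rewrite /dotr /dskew_sum mulr_sumr; apply: eq_bigr => i _.
rewrite xE !mxE; case: ifP => iI; rewrite ?iI.
  by rewrite dskewpow_le0_arg ?ltW//; ring.
by rewrite dskewpow_ge0_arg ?ltW//; ring.
Qed.

End flux.

Lemma skewpow_antitone (q t t' x : R) : 1 < q -> 0 < t' -> t' <= t ->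
  skewpow q t x <= skewpow q t' x.
Proof.
move=> q1 t'0 tt'; have t0 := lt_le_trans t'0 tt'.
have q0 : 0 < q by apply: lt_trans q1.
rewrite /skewpow lerD2l /pospow; apply: ge0_ler_powR; first exact: ltW.
- by rewrite nnegrE le_max lexx orbT.
- by rewrite nnegrE le_max lexx orbT.
rewrite ge_max !le_max lexx orbT andbT.
have [x0|x0] := leP x 0; last first.
  by apply/orP; right; rewrite pmulr_lle0 ?invr_gt0// oppr_le0 ltW.
by apply/orP; left; rewrite ler_wpM2l ?oppr_ge0// lef_pV2.
Qed.

(** * The nonnegative part of the ball as a limit of skew balls *)

Section limit.
Variables (q : R) (n : nat).
Hypothesis q1 : 1 < q.
Variables (v : 'rV[R]_n.+1) (U : 'M[R]_(n, n.+1)).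
Hypotheses (v1 : dotr v v = 1) (Uv : perp_basis v U).

Notation e i := (delta_mx 0 i : 'rV[R]_n.+1).
Notation J := (@orthant_flux q n.+1).

Let q0 : 0 < q. Proof. by apply: lt_trans q1. Qed.
Let k0 : 0 < 2 * layer_mass q n. Proof. by rewrite mulr_gt0// layer_mass_gt0. Qed.

(** The flux of the unit ball of skew_sum in direction v, up to the factor q. *)
Definition flux_sum (tau : R) : R :=
  \sum_(I : {set 'I_n.+1}) tau ^+ #|I| * J (flip_weight tau I v).

Lemma shadow_volE tau : 0 < tau ->
  lam n (shadow q tau v U) = (q / (2 * layer_mass q n) * flux_sum tau)%:E.
Proof.
move=> tau0; have := shadow_formula q1 tau0 v1 Uv.
rewrite flux_orthants// => h.
have := congr1 (fun z => ((2 * layer_mass q n)^-1%:E * z)%E) h.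
rewrite muleA -!EFinM mulVf ?(lt0r_neq0 k0)// mul1e => <-.
by congr EFin; rewrite mulrA [_^-1 * q]mulrC.
Qed.

(** The coordinates in the frame U of the projection of the nonnegative part
    of the l_q ball. *)
Definition pos_shadow : set (tupleR n) :=
  [set y | exists s, (forall i, 0 <= (rv y *m U + s *: v) 0 i) /\
     \sum_i `|(rv y *m U + s *: v) 0 i| `^ q <= 1].

Lemma harmonic_le k l : (k <= l)%N -> harmonic l <= harmonic k :> R.
Proof. by move=> kl; rewrite /harmonic/= lef_pV2 ?posrE// ler_nat. Qed.

Lemma skew_sum_antitone (t t' : R) (x : 'rV[R]_n.+1) : 0 < t' -> t' <= t ->
  skew_sum q t x <= skew_sum q t' x.
Proof. by move=> t0 tt; apply: ler_sum => i _; exact: skewpow_antitone. Qed.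

Lemma shadow_noninc : nonincreasing_seq (fun k => shadow q (harmonic k) v U).
Proof.
move=> k l kl; apply/subsetPset => y [s ys]; exists s; apply: le_trans ys.
by apply: skew_sum_antitone; [exact: harmonic_gt0|exact: harmonic_le].
Qed.

(** Bounded penalties (|x_i| / tau)^q for all tau = 1 / (k + 1) force x_i to be
    nonnegative. *)
Lemma skew_sum_harmonicP (x : 'rV[R]_n.+1) :
  (forall k, skew_sum q (harmonic k) x <= 1) <->
  (forall i, 0 <= x 0 i) /\ \sum_i `|x 0 i| `^ q <= 1.
Proof.
have PhiE t : 0 < t -> (forall i, 0 <= x 0 i) -> skew_sum q t x = \sum_i `|x 0 i| `^ q.
  by move=> t0 x0; apply: eq_bigr => i _; rewrite skewpow_ge0_arg// ger0_norm.
split=> [h|[x0 xb] k]; last by rewrite PhiE// harmonic_gt0.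
have x0 i : 0 <= x 0 i.
  rewrite leNgt; apply/negP => xi.
  have hk k : - x 0 i <= harmonic k.
    have t0 : 0 < harmonic k :> R by exact: harmonic_gt0.
    have : skewpow q (harmonic k) (x 0 i) <= 1.
      apply: le_trans (h k); rewrite /skew_sum (bigD1 i)//= lerDl.
      by apply: sumr_ge0 => j _; exact: skewpow_ge0.
    rewrite [X in skewpow _ _ X](_ : _ = - harmonic k * (- x 0 i / harmonic k));
      last first.
      by field; rewrite gt_eqF.
    rewrite skewpow_le0_arg//; last by apply: divr_ge0; rewrite ?oppr_ge0; exact: ltW.
    rewrite leNgt => /negP H; rewrite leNgt; apply/negP => H'; apply: H.
    have e1 : (1 : R) `^ q = 1 by rewrite powR1.
    rewrite -[ltLHS]e1; apply: gt0_ltr_powR; rewrite ?nnegrE//.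
      by apply: divr_ge0; rewrite ?oppr_ge0; exact: ltW.
    by rewrite ltr_pdivlMr// mul1r.
  have [k] := @ltr_add_invr R 0 (- x 0 i) ltac:(by rewrite oppr_gt0).
  by rewrite add0r ltNge hk.
split => //; rewrite -(PhiE (harmonic 0%N)) ?harmonic_gt0//; exact: h.
Qed.

(** A line that meets all the skew balls meets their intersection, as these
    sets are nested and cut the line in compact sets. *)
Lemma pos_shadowE : pos_shadow = \bigcap_k shadow q (harmonic k) v U.
Proof.
apply/seteqP; split => y.
  by move=> [s /skew_sum_harmonicP h] k _; exists s; exact: h.
move=> h; have {}h k : exists s, skew_sum q (harmonic k) (rv y *m U + s *: v) <= 1.
  exact: h.
pose S k : set R := [set s | skew_sum q (harmonic k) (rv y *m U + s *: v) <= 1].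
have [s_ s_P] : {s_ : nat -> R & forall k, S k (s_ k)} by exact: choice.
have Sdec k l : (k <= l)%N -> S l `<=` S k.
  move=> kl s; apply: le_trans; apply: skew_sum_antitone;
    [exact: harmonic_gt0|exact: harmonic_le].
have /rV0Pn[i vi] := direction_neq0 v1.
(* On the line, |x_i| <= 1 for a coordinate with v_i <> 0 bounds the parameter. *)
pose M := (1 + `|(rv y *m U) 0 i|) / `|v 0 i|.
have SM : S 0%N `<=` `[- M, M]%classic.
  move=> s; rewrite /S/= in_itv/= -ler_norml => hs.
  have : `|(rv y *m U + s *: v) 0 i| `^ q <= 1.
    rewrite -skewpow1//; apply: le_trans hs;
      rewrite ?invr1 /skew_sum (bigD1 i)//= lerDl.
    by apply: sumr_ge0 => j _; exact: skewpow_ge0.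
  move=> hi; have {}hi : `|(rv y *m U + s *: v) 0 i| <= 1.
    rewrite leNgt; apply/negP => lt1; move: hi; rewrite leNgt => /negP; apply.
    have e1 : (1 : R) `^ q = 1 by rewrite powR1.
    by rewrite -[ltLHS]e1; apply: gt0_ltr_powR; rewrite ?nnegrE.
  rewrite /M ler_pdivlMr ?normr_gt0// -normrM.
  move: hi; rewrite !mxE => hi.
  rewrite -[s * _](addrK (\sum_j rv y 0 j * U j i)) [s * _ + _]addrC.
  by apply: le_trans (ler_normB _ _) _; rewrite lerD2r.
have closedS k : closed (S k).
  rewrite (_ : S k =
    (fun s => skew_sum q (harmonic k) (rv y *m U + s *: v)) @^-1` [set z | z <= 1]);
      last by [].
  apply: closed_comp => [s _|]; last exact: closed_le.
  apply/differentiable_continuous/derivable1_diffP/ex_derive.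
  exact: is_derive_skew_sum.
have [s [_ cs]] : (`[- M, M] `&` cluster (s_ @ \oo)) !=set0.
  apply: segment_compact; exists 0%N => // k _ /=.
  by apply: SM; apply: (Sdec 0%N k) => //; exact: s_P.
exists s; apply/skew_sum_harmonicP => k.
suff : S k s by [].
apply: closedS => B nB; apply: cs => //.
exists k => // l /= kl; apply: (Sdec k l kl); exact: s_P.
Qed.

End limit.

(** * The limit of the flux *)

Section flux_limit.
Variables (q : R) (n : nat).
Hypothesis q1 : 1 < q.
Variables (v : 'rV[R]_n.+1).

Notation e i := (delta_mx 0 i : 'rV[R]_n.+1).
Notation J := (@orthant_flux q n.+1).

(** The flux of v through the flat facets of the nonnegative part of the ball. *)
Definition axis_flux : R := \sum_i `|v 0 i| * J (e i).

Let axis_flux_ge0 : 0 <= axis_flux.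
Proof. by apply: sumr_ge0 => i _; rewrite mulr_ge0 ?orthant_flux_ge0. Qed.

(** The limit of the term of flux_sum indexed by I: the curved boundary for the
    empty set, the facet x_i = 0 for {i}, and 0 for larger sets. *)
Definition limit_term (I : {set 'I_n.+1}) : R :=
  (if I == finset.set0 then J v else 0) +
  \sum_i (if I == [set i]%SET then `|v 0 i| * J (e i) else 0).

Lemma sum_limit_term : \sum_I limit_term I = J v + axis_flux.
Proof.
rewrite big_split/= -big_mkcond big_pred1_eq exchange_big/=; congr (_ + _).
by apply: eq_bigr => i _; rewrite -big_mkcond big_pred1_eq.
Qed.

Lemma set0_neq1 (i : 'I_n.+1) : (finset.set0 == [set i]%SET) = false.
Proof. by apply/negbTE; rewrite eq_sym -finset.card_gt0 finset.cards1. Qed.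

(** Write the term as tau^(#|I| - 1) J(tau w) with w the flipped weight.  The
    entries of tau w are - v_l for l in I and tau v_l for the others, so
    tau w is within tau |v| of - v_l e_l, entry by entry, when I = {l}, while
    the leading factor is at most tau when I has two elements or more. *)
Lemma flux_term_bound (tau : R) (I : {set 'I_n.+1}) : 0 < tau <= 1 ->
  `|tau ^+ #|I| * J (flip_weight tau I v) - limit_term I| <= tau * axis_flux.
Proof.
move=> /andP[t0 t1]; rewrite /limit_term.
have [I0|/finset.set0Pn[i iI]] := eqVneq I finset.set0.
  rewrite I0 big1 ?addr0 => [|i _]; last by rewrite set0_neq1.
  rewrite finset.cards0 expr0 mul1r (_ : flip_weight _ _ _ = v).
    by rewrite subrr normr0 mulr_ge0// ltW.
  by apply/rowP => i; rewrite mxE finset.in_set0.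
have tflip l : (tau *: flip_weight tau I v) 0 l =
  if l \in I then - v 0 l else tau * v 0 l.
  by rewrite !mxE; case: ifP => lI; rewrite ?lI// mulrN mulVKf// gt_eqF.
have e1 : tau ^+ #|I| * J (flip_weight tau I v) =
  tau ^+ #|I|.-1 * J (tau *: flip_weight tau I v).
  rewrite orthant_flux_homog// gtr0_norm// mulrA -exprSr prednK//.
  by rewrite finset.card_gt0; apply/finset.set0Pn; exists i.
rewrite add0r e1; have [/finset.cards1P[l Il]|cI] := boolP (#|I| == 1%N).
  rewrite Il (bigD1 l)//= eqxx big1 ?addr0 => [|j jl]; last first.
    by rewrite (inj_eq finset.set1_inj) eq_sym (negbTE jl).
  rewrite finset.cards1 expr0 mul1r -Il.
  have e2 : `|v 0 l| * J (e l) = J (- v 0 l *: e l).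
    by rewrite orthant_flux_homog// normrN.
  have b : \sum_k `|(tau *: flip_weight tau I v) 0 k - (- v 0 l *: e l) 0 k| * J (e k)
    <= tau * axis_flux.
    rewrite /axis_flux mulr_sumr; apply: ler_sum => k _.
    rewrite mulrA ler_wpM2r ?orthant_flux_ge0// tflip Il finset.in_set1 !mxE eqxx/=.
    case: eqP => [->|_]; last by rewrite mulr0 subr0 normrM gtr0_norm.
    by rewrite mulr1 subrr normr0 mulr_ge0// ltW.
  rewrite e2 ler_distl; apply/andP; split; last first.
    by apply: le_trans (orthant_flux_lip q1 _ (- v 0 l *: e l)) _; rewrite lerD2l.
  rewrite lerBlDr; apply: le_trans (orthant_flux_lip q1 _ (tau *: flip_weight tau I v))
    _.
  by rewrite lerD2l; under eq_bigr do rewrite distrC.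
rewrite big1 ?subr0 => [|l _]; last first.
  by case: eqP => // Il; move: cI; rewrite Il finset.cards1.
rewrite ger0_norm ?mulr_ge0 ?exprn_ge0 ?orthant_flux_ge0 ?(ltW t0)//.
have I2 : (1 < #|I|)%N.
  by rewrite ltn_neqAle eq_sym cI finset.card_gt0; apply/finset.set0Pn; exists i.
apply: ler_pM; rewrite ?exprn_ge0 ?orthant_flux_ge0 ?(ltW t0)//.
  by rewrite -[leRHS]expr1 ler_wiXn2l// ?(ltW t0)// -ltnS prednK// (ltn_trans _ I2).
apply: le_trans (orthant_flux_ub q1 _) _; apply: ler_sum => l _.
rewrite ler_wpM2r ?orthant_flux_ge0// tflip; case: ifP => _; first by rewrite normrN.
by rewrite normrM gtr0_norm// ler_piMl.
Qed.

Lemma flux_cvg : flux_sum q v (harmonic k) @[k --> \oo] --> J v + axis_flux.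
Proof.
pose C := \sum_(I : {set 'I_n.+1}) axis_flux.
have CB (k : nat) : `|flux_sum q v (harmonic k) - (J v + axis_flux)| <= harmonic k * C.
  rewrite -sum_limit_term /flux_sum -sumrB mulr_sumr.
  apply: le_trans (ler_norm_sum _ _ _) _; apply: ler_sum => I _.
  apply: flux_term_bound; rewrite harmonic_gt0/=.
  by have := @harmonic_le 0 k (leq0n k); rewrite /harmonic/= invr1.
have h0 : harmonic k * C @[k --> \oo] --> (0 : R).
  by rewrite -(mul0r C); apply: cvgM; [exact: cvg_harmonic|exact: cvg_cst].
apply: (@squeeze_cvgr _ _ _ _ (fun k => (J v + axis_flux) - harmonic k * C)
  (fun k => (J v + axis_flux) + harmonic k * C)).
- by apply: nearW => k; have := CB k; rewrite ler_distl.
- by rewrite -[X in _ --> X]subr0; apply: cvgB => //; exact: cvg_cst.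
- by rewrite -[X in _ --> X]addr0; apply: cvgD => //; exact: cvg_cst.
Qed.

Variable (U : 'M[R]_(n, n.+1)).
Hypotheses (v1 : dotr v v = 1) (Uv : perp_basis v U).

Lemma pos_shadow_vol :
  lam n (pos_shadow q v U) = (q / (2 * layer_mass q n) * (J v + axis_flux))%:E.
Proof.
rewrite (pos_shadowE q1 U v1).
have mS k : measurable (shadow q (harmonic k) v U).
  exact: (measurable_shadow q1 (harmonic_gt0 k) v1 Uv).
have := @nonincreasing_cvg_mu _ _ R (lam n) (fun k => shadow q (harmonic k) v U).
have fin0 : (lam n (shadow q (harmonic 0%N) v U) < +oo)%E.
  by rewrite (shadow_volE q1 v1 Uv (harmonic_gt0 0)) ltry.
move=> /(_ fin0 mS (bigcapT_measurable mS) (@shadow_noninc q n q1 v U)) cv.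
have cv' : (lam n \o (fun k => shadow q (harmonic k) v U)) k @[k --> \oo] -->
    (q / (2 * layer_mass q n) * (J v + axis_flux))%:E.
  apply: (@cvg_trans _ ((q / (2 * layer_mass q n) * flux_sum q v (harmonic k))%:E @[k
    --> \oo])).
    apply: near_eq_cvg; apply: nearW => k /=.
    by rewrite shadow_volE// harmonic_gt0.
  apply: cvg_EFin; first exact: nearW.
  by apply: cvgM; [exact: cvg_cst|exact: flux_cvg].
exact: (cvg_unique _ cv cv').
Qed.

End flux_limit.

(** * Signed sums of real numbers *)

Section rademacher.
Context {d : nat}.
Implicit Types (I B : {set 'I_d}) (z : 'I_d -> R).

Definition signed_sum I z : R := \sum_i (if i \in I then - z i else z i).

(** Flipping the signs of the indices in B is an involution on sign patterns,
    so the signed sums can be summed in pairs I, symdiff I B. *)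
Definition symdiff I B : {set 'I_d} := [set i | (i \in I) (+) (i \in B)]%SET.

Lemma in_symdiff I B i : (i \in symdiff I B) = (i \in I) (+) (i \in B).
Proof. by rewrite finset.in_set. Qed.

Lemma symdiffK B : involutive (symdiff ^~ B).
Proof. by move=> I; apply/setP => i; rewrite !inE -addbA addbb addbF. Qed.

Lemma sum_symdiff (V : nmodType) B (F : {set 'I_d} -> V) :
  \sum_I F (symdiff I B) = \sum_I F I.
Proof. by rewrite [RHS](reindex_inj (inv_inj (symdiffK B))). Qed.

(** Both sides are twice a maximum: |a + b| + |a - b| = 2 max(|a|, |b|) and
    |P - M| + (P + M) = 2 max(P, M) for P, M >= 0. *)
Lemma norm_max_le (a b P M : R) : `|a| <= P -> `|b| <= M ->
  `|a + b| + `|a - b| <= `|P - M| + (P + M).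
Proof.
rewrite !ler_norml => /andP[aP1 aP2] /andP[bM1 bM2].
by case: (ler0P (a + b)); case: (ler0P (a - b)); case: (ler0P (P - M)); lra.
Qed.

Lemma norm_max_eq (a b P M : R) : `|a| = P -> `|b| = M ->
  `|a + b| + `|a - b| = `|P - M| + (P + M).
Proof.
move=> <- <-.
by case: (ler0P (`|a| - `|b|)); case: (ler0P a); case: (ler0P b);
  case: (ler0P (a + b)); case: (ler0P (a - b)); lra.
Qed.

Let neg z : {set 'I_d} := [set i | z i < 0]%SET.

Let sA z I : R := \sum_(i | i \notin neg z) (if i \in I then - z i else z i).
Let sB z I : R := \sum_(i | i \in neg z) (if i \in I then - z i else z i).
Let P z : R := \sum_(i | i \notin neg z) `|z i|.
Let M z : R := \sum_(i | i \in neg z) `|z i|.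

Let signed_sumE z I : signed_sum I z = sA z I + sB z I.
Proof. by rewrite /signed_sum (bigID (mem (neg z)))/= addrC. Qed.

Let signed_sum_symdiffE z I : signed_sum (symdiff I (neg z)) z = sA z I - sB z I.
Proof.
rewrite /signed_sum (bigID (mem (neg z)))/= addrC -sumrN; congr (_ + _);
  apply: eq_bigr => i iB; rewrite [i \in symdiff _ _]finset.in_set.
  by rewrite (negbTE iB) addbF.
by rewrite iB addbT; case: (i \in I); rewrite //= opprK.
Qed.

Let sum_z z : \sum_i z i = P z - M z.
Proof.
rewrite (bigID (mem (neg z)))/= addrC -sumrN; congr (_ + _); apply: eq_bigr => i;
  rewrite finset.in_set => zi; first by rewrite ger0_norm// leNgt.
by rewrite ltr0_norm// opprK.
Qed.

Let sum_abs_z z : \sum_i `|z i| = P z + M z.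
Proof. by rewrite (bigID (mem (neg z)))/= addrC. Qed.

Let sum_const (c : R) : \sum_(I : {set 'I_d}) c = 2 ^+ d * c.
Proof.
rewrite sumr_const -[LHS]mulr_natl; congr (_ * c).
rewrite (_ : #|_| = #|finset.powerset [set: 'I_d]%SET|).
  by rewrite finset.card_powerset finset.cardsT card_ord natrX.
by apply: eq_card => I; rewrite finset.powersetE finset.subsetT.
Qed.

Let double_sum z : 2 * \sum_I `|signed_sum I z| =
  \sum_I (`|sA z I + sB z I| + `|sA z I - sB z I|).
Proof.
rewrite mulr2n mulrDl mul1r -[X in _ + X](sum_symdiff (neg z)) -big_split/=.
by apply: eq_bigr => I _; rewrite signed_sumE signed_sum_symdiffE.
Qed.

(** Pair the sign patterns that differ exactly on the indices where z is
    negative.  A signed sum is a + b with b the part over these indices, and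
    its partner is a - b; here |a| is at most the sum P of the positive parts
    of z and |b| at most the sum M of the negative parts, while
    |sum z| = |P - M| and sum |z| = P + M. *)
Lemma rademacher_le z :
  2 * \sum_I `|signed_sum I z| <= 2 ^+ d * (`|\sum_i z i| + \sum_i `|z i|).
Proof.
rewrite double_sum -sum_const; apply: ler_sum => I _.
rewrite sum_z sum_abs_z; apply: norm_max_le.
- apply: le_trans (ler_norm_sum _ _ _) _; apply: ler_sum => i _.
  by case: ifP => _; rewrite ?normrN.
- apply: le_trans (ler_norm_sum _ _ _) _; apply: ler_sum => i _.
  by case: ifP => _; rewrite ?normrN.
Qed.

Let norm_sum_one (Q : pred 'I_d) (x y : 'I_d -> R) :
  (forall i, `|x i| = `|y i|) ->
  (forall i j, Q i -> Q j -> i != j -> y i * y j = 0) ->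
  `|\sum_(i | Q i) x i| = \sum_(i | Q i) `|y i|.
Proof.
move=> xy yy.
have [i /andP[Qi yi]|h] := pickP (fun i => Q i && (y i != 0)).
  have x0 j : Q j && (j != i) -> y j = 0.
    move=> /andP[Qj ji]; have /eqP := yy _ _ Qi Qj ltac:(by rewrite eq_sym).
    by rewrite mulf_eq0 (negbTE yi) => /eqP.
  rewrite (bigD1 i)//= [RHS](bigD1 i)//= big1 ?addr0; last first.
    by move=> j /x0 yj; apply/eqP; rewrite -normr_eq0 xy yj normr0.
  by rewrite xy big1 ?addr0// => j /x0 ->; rewrite normr0.
have y0 j : Q j -> y j = 0.
  by move=> Qj; have := h j; rewrite Qj/= => /negbT; rewrite negbK => /eqP.
rewrite big1 ?normr0 => [|j /y0 yj]; last by apply/eqP; rewrite -normr_eq0 xy yj normr0.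
by rewrite big1// => j /y0 ->; rewrite normr0.
Qed.

(** With at most one positive and at most one negative entry there is no
    cancellation inside the two parts of the previous bound. *)
Lemma rademacher_eq z : (forall i j, i != j -> z i * z j <= 0) ->
  2 * \sum_I `|signed_sum I z| = 2 ^+ d * (`|\sum_i z i| + \sum_i `|z i|).
Proof.
move=> zz; rewrite double_sum -sum_const; apply: eq_bigr => I _.
rewrite sum_z sum_abs_z; apply: norm_max_eq; apply: norm_sum_one.
- by move=> i; case: ifP => _; rewrite ?normrN.
- move=> i j; rewrite !finset.in_set -!leNgt => zi zj ij.
  by apply/eqP; rewrite eq_le zz//= mulr_ge0.
- by move=> i; case: ifP => _; rewrite ?normrN.
- move=> i j; rewrite !finset.in_set => zi zj ij.
  by have := zz _ _ ij; rewrite leNgt nmulr_rgt0// zj.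
Qed.

(** Pair the sign patterns that differ at i alone: if the other entries add up
    to eta, each pair is at most 2 max(|z_i|, |z_j|) + 2 eta, while the right
    side is at least 2 (|z_i| + |z_j|) per pair because z_i and z_j have the
    same sign.  The gap is 2 (min(|z_i|, |z_j|) - eta). *)
Lemma rademacher_lt z i j : i != j -> 0 < z i * z j ->
  \sum_(k | (k != i) && (k != j)) `|z k| < Num.min `|z i| `|z j| ->
  2 * \sum_I `|signed_sum I z| < 2 ^+ d * (`|\sum_i z i| + \sum_i `|z i|).
Proof.
set eta := \sum_(k | _) _ => ij zij; rewrite lt_min => /andP[ei ej].
have split2 (F : 'I_d -> R) : \sum_k F k =
  F i + F j + \sum_(k | (k != i) && (k != j)) F k.
  by rewrite (bigD1 i)//= (bigD1 j) 1?eq_sym//= addrA.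
pose mx := Num.max `|z i| `|z j|.
have eta0 : 0 <= eta by apply: sumr_ge0.
have upper : 2 * \sum_I `|signed_sum I z| <= \sum_(I : {set 'I_d}) (2 * mx + 2 * eta).
  rewrite mulr2n mulrDl mul1r -[X in _ + X](sum_symdiff [set i]%SET) -big_split/=.
  apply: ler_sum => I _.
  rewrite /signed_sum !split2 !in_symdiff !finset.in_set1 eqxx [j == i]eq_sym (negbTE
    ij) addbT addbF.
  have b (A : {set 'I_d}) :
      `|\sum_(k | (k != i) && (k != j)) (if k \in A then - z k else z k)| <= eta.
    apply: le_trans (ler_norm_sum _ _ _) _; apply: ler_sum => k _.
    by case: ifP => _; rewrite ?normrN.
  have b1 := b I; have := b (symdiff I [set i]%SET).
  set r1 := \sum_(k | _) _ in b1 *; set r2 := \sum_(k | _) _ => b2.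
  have mxi : `|z i| <= mx by rewrite le_max lexx.
  have mxj : `|z j| <= mx by rewrite le_max lexx orbT.
  have key (x y : R) : `|x| = `|z i| -> `|y| = `|z j| ->
      `|x + y + r1| + `|- x + y + r2| <= 2 * mx + 2 * eta.
    move=> xz yz.
    have e1 : `|x + y| + `|x - y| <= 2 * mx.
      rewrite (norm_max_eq erefl erefl) xz yz.
      by case: (ler0P (`|z i| - `|z j|)); lra.
    have := ler_normD (x + y) r1; have := ler_normD (- x + y) r2.
    have -> : `|- x + y| = `|x - y| by rewrite -normrN opprD opprK.
    lra.
  case: (i \in I); case: (j \in I) => /=.
  - by have := key (- z i) (- z j); rewrite !normrN opprK; apply.
  - by have := key (- z i) (z j); rewrite !normrN opprK; apply.
  - by have := key (z i) (- z j); rewrite !normrN; apply.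
  - exact: key.
apply: le_lt_trans upper _; rewrite sum_const ltr_pM2l ?exprn_gt0//.
have zz : `|z i + z j| = `|z i| + `|z j|.
  move: zij; case: (ltgtP (z i) 0) => zi; last by rewrite zi mul0r ltxx.
    by rewrite nmulr_rgt0// => zj; rewrite !ltr0_norm//; lra.
  by rewrite pmulr_rgt0// => zj; rewrite !gtr0_norm//; lra.
rewrite !split2 -/eta.
have : `|z i + z j| - eta <= `|z i + z j + \sum_(k | (k != i) && (k != j)) z k|.
  have he : `|\sum_(k | (k != i) && (k != j)) z k| <= eta by exact: ler_norm_sum.
  have := ler_normB (z i + z j +
    \sum_(k | (k != i) && (k != j)) z k) (\sum_(k | (k != i) && (k != j)) z k).
  rewrite addrK; lra.
rewrite zz => h.
have mxlt : mx + eta < `|z i| + `|z j|.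
  by rewrite /mx; case: (leP `|z i| `|z j|); lra.
lra.
Qed.

End rademacher.

(** * The norm given by the volumes of the projections of the ball *)

Section norm.
Variables (q : R) (n : nat).
Hypothesis q1 : 1 < q.
Implicit Types (v w : 'rV[R]_n.+1).

Notation e i := (delta_mx 0 i : 'rV[R]_n.+1).
Notation J := (@orthant_flux q n.+1).
Notation N w := (flux_sum q w 1).

Lemma dotr_flip I w (a : 'rV[R]_n.+1) :
  dotr (flip_weight 1 I w) a = signed_sum I (fun i => w 0 i * a 0 i).
Proof.
apply: eq_bigr => i _; rewrite mxE invr1 mul1r; case: ifP => // _.
by rewrite mulNr.
Qed.

Lemma flux_sum1E w : N w = \sum_(A : {set 'I_n.+1}) J (flip_weight 1 A w).
Proof. by apply: eq_bigr => I _; rewrite expr1n mul1r. Qed.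

(** The families of weights whose pointwise comparison is the inequality on
    signed sums, applied to z_i = w_i a_i. *)
Definition signed_family w : seq (R * 'rV[R]_n.+1) :=
  [seq (2, flip_weight 1 A w) | A <- index_enum {set 'I_n.+1}].
Definition bound_family w : seq (R * 'rV[R]_n.+1) :=
  (2 ^+ n.+1, w) :: [seq (2 ^+ n.+1 * `|w 0 i|, e i) | i <- index_enum 'I_n.+1].

Lemma signed_familyE w : \sum_(p <- signed_family w) p.1 * J p.2 = 2 * N w.
Proof. by rewrite big_map flux_sum1E mulr_sumr. Qed.

Lemma bound_familyE w :
  \sum_(p <- bound_family w) p.1 * J p.2 = 2 ^+ n.+1 * (J w + axis_flux q w).
Proof.
rewrite big_cons big_map/= mulrDr mulr_sumr; congr (_ + _).
by apply: eq_bigr => i _; rewrite mulrA.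
Qed.

Lemma signed_family_pointwise w (a : 'rV[R]_n.+1) :
  \sum_(p <- signed_family w) p.1 * `|dotr p.2 a| =
  2 * \sum_(A : {set 'I_n.+1}) `|signed_sum A (fun i => w 0 i * a 0 i)|.
Proof. by rewrite big_map mulr_sumr; apply: eq_bigr => I _; rewrite dotr_flip. Qed.

Lemma bound_family_pointwise w (a : 'rV[R]_n.+1) : (forall i, 0 <= a 0 i) ->
  \sum_(p <- bound_family w) p.1 * `|dotr p.2 a| =
  2 ^+ n.+1 * (`|\sum_i w 0 i * a 0 i| + \sum_i `|w 0 i * a 0 i|).
Proof.
move=> a0; rewrite big_cons big_map/= mulrDr mulr_sumr; congr (_ + _).
by apply: eq_bigr => i _; rewrite dotr_delta -mulrA normrM.
Qed.

Lemma flux_sum1_le w : 2 * N w <= 2 ^+ n.+1 * (J w + axis_flux q w).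
Proof.
rewrite -signed_familyE -bound_familyE; apply: orthant_flux_le => // a a0.
by rewrite signed_family_pointwise bound_family_pointwise// rademacher_le.
Qed.

Lemma flux_sum1_eq w : (forall i j, i != j -> w 0 i * w 0 j <= 0) ->
  2 * N w = 2 ^+ n.+1 * (J w + axis_flux q w).
Proof.
move=> ww; rewrite -signed_familyE -bound_familyE; apply: orthant_flux_eq => // a a0.
rewrite signed_family_pointwise bound_family_pointwise// rademacher_eq// => i j ij.
by rewrite mulrACA mulr_le0_ge0// ?ww// mulr_ge0.
Qed.

Lemma small_in_pos_ball (x : tupleR n.+1) :
  (forall i, 0 < tnth x i <= n.+1%:R^-1) -> in_pos_ball q x.
Proof.
move=> h; apply/andP; split; first by apply/pos_orthantP => i; have /andP[] := h i.
apply: (@le_trans _ _ (\sum_(i < n.+1) n.+1%:R^-1)).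
  apply: ler_sum => i _; have /andP[x0 xn] := h i.
  apply: le_trans xn; apply: ge1r_powR; last exact: ltW.
  by rewrite x0/= (le_trans (proj2 (andP (h i))))// invf_le1// ler1n.
by rewrite sumr_const card_ord -[leLHS]mulr_natl divff.
Qed.

(** Where two entries of w have the same sign, the inequality is strict near the
    points whose coordinates i and j are of order r = 1 / (n + 1) while the
    others are tiny. *)
Lemma flux_sum1_lt w i j : i != j -> 0 < w 0 i * w 0 j ->
  2 * N w < 2 ^+ n.+1 * (J w + axis_flux q w).
Proof.
move=> ij wij; rewrite -signed_familyE -bound_familyE.
pose r : R := n.+1%:R^-1.
have r0 : 0 < r by rewrite invr_gt0.
have p0 : 0 < q - 1 by rewrite subr_gt0.
have wi : 0 < `|w 0 i|.
  by rewrite normr_gt0; apply/eqP => wi; move: wij; rewrite wi mul0r ltxx.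
have wj : 0 < `|w 0 j|.
  by rewrite normr_gt0; apply/eqP => wj; move: wij; rewrite wj mulr0 ltxx.
pose m := Num.min `|w 0 i| `|w 0 j| * (r / 2) `^ (q - 1).
have m0 : 0 < m by rewrite mulr_gt0 ?powR_gt0 ?divr_gt0// lt_min wi.
pose V := \sum_k `|w 0 k|.
have V0 : 0 <= V by apply: sumr_ge0.
(* delta is so small that the other coordinates contribute less than m, a
   lower bound for |w_i a_i| and |w_j a_j|. *)
pose delta := Num.min r ((m / (1 + V)) `^ (q - 1)^-1).
have mV : 0 < m / (1 + V) by rewrite divr_gt0// ltr_pwDl.
have d0 : 0 < delta by rewrite lt_min r0 powR_gt0.
have dr : delta <= r by rewrite ge_min lexx.
have dm : delta `^ (q - 1) <= m / (1 + V).
  have -> : m / (1 + V) = ((m / (1 + V)) `^ (q - 1)^-1) `^ (q - 1).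
    by rewrite -powRrM mulVf ?gt_eqF// powRr1// ltW.
  apply: ge0_ler_powR; rewrite ?nnegrE ?powR_ge0 ?(ltW p0) ?(ltW d0)//.
  by rewrite ge_min lexx orbT.
pose hi k := if (k == i) || (k == j) then r else delta.
have hi0 k : 0 < hi k by rewrite /hi; case: ifP.
apply: (@orthant_flux_lt q _ q1 _ _ (fun k => hi k / 2) hi).
- move=> a a0; rewrite signed_family_pointwise bound_family_pointwise//;
  exact: rademacher_le.
- by move=> k; have := hi0 k; lra.
move=> x hx.
have x0 k : 0 < tnth x k.
  by have /andP[+ _] := hx k; apply: lt_le_trans; rewrite divr_gt0.
have xb : in_pos_ball q x.
  apply: small_in_pos_ball => k; rewrite x0/=; have /andP[_] := hx k.
  by move=> /le_trans; apply; rewrite /hi; case: ifP.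
split => //; rewrite signed_family_pointwise bound_family_pointwise; last first.
  by move=> k; rewrite mxE powR_ge0.
have a0 k : 0 < conormal q x 0 k by rewrite mxE powR_gt0.
apply: (@rademacher_lt _ _ i j) => //.
  by rewrite mulrACA mulr_gt0// mulr_gt0.
apply: (@lt_le_trans _ _ m); last first.
  have low k : (k == i) || (k == j) -> (r / 2) `^ (q - 1) <= conormal q x 0 k.
    move=> kij; rewrite mxE; apply: ge0_ler_powR;
      rewrite ?nnegrE ?(ltW p0) ?(ltW (x0 _)) ?divr_ge0 ?(ltW r0)//.
    by have /andP[] := hx k; rewrite /hi kij.
  rewrite /m le_min; apply/andP; split; rewrite normrM [`|conormal _ _ _ _|]gtr0_norm//;
    apply: ler_pM; rewrite ?powR_ge0 ?le_min ?normr_ge0 ?low ?eqxx ?orbT// ge_min lexx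
      ?orbT//.
apply: (@le_lt_trans _ _ (V * delta `^ (q - 1))).
  rewrite /V mulr_suml [leRHS](bigID (fun k => (k != i) && (k != j)))/=.
  apply: ler_wpDr.
    by apply: sumr_ge0 => k _; rewrite mulr_ge0 ?powR_ge0.
  apply: ler_sum => k /andP[ki kj];
    rewrite normrM [`|conormal _ _ _ _|]gtr0_norm// ler_wpM2l// mxE.
  apply: ge0_ler_powR; rewrite ?nnegrE ?(ltW p0) ?(ltW (x0 _)) ?(ltW d0)//.
  by have /andP[_] := hx k; rewrite /hi (negbTE ki) (negbTE kj).
apply: (@le_lt_trans _ _ (V * (m / (1 + V)))); first by rewrite ler_wpM2l.
rewrite mulrA ltr_pdivrMr ?ltr_pwDl// mulrC ltr_pM2l//; lra.
Qed.

(** The integrand is positive on a box inside the ball. *)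
Lemma orthant_flux_delta_gt0 i : 0 < J (e i).
Proof.
pose r : R := n.+1%:R^-1.
have r0 : 0 < r by rewrite invr_gt0.
have := @orthant_flux_lt q _ q1 [::] [:: (1, e i)] (fun=> r / 2) (fun=> r).
rewrite big_nil big_seq1 mul1r; apply.
- by move=> a a0; rewrite big_nil big_seq1 mul1r.
- by move=> k; lra.
move=> x hx.
have x0 k : 0 < tnth x k.
  by have /andP[+ _] := hx k; apply: lt_le_trans; rewrite divr_gt0.
split; first by apply: small_in_pos_ball => k; rewrite x0/=; have /andP[] := hx k.
by rewrite big_nil big_seq1 mul1r dotr_delta normr_gt0 mxE gt_eqF// powR_gt0.
Qed.

Lemma orthant_flux_delta i : J (e i) = J (e ord0).
Proof.
rewrite -(orthant_flux_perm (tperm i ord0) (e ord0) q1); congr (J _).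
apply/rowP => k; rewrite !mxE !eqxx/=; congr (_%:R).
by rewrite (canF_eq (tpermK i ord0)) tpermR.
Qed.

Lemma axis_fluxE w : axis_flux q w = (\sum_i `|w 0 i|) * J (e ord0).
Proof. by rewrite mulr_suml; apply: eq_bigr => i _; rewrite orthant_flux_delta. Qed.

Lemma flux_sum1_delta : N (e ord0) = 2 ^+ n.+1 * J (e ord0).
Proof.
have := @flux_sum1_eq (e ord0).
have -> : axis_flux q (e ord0) = J (e ord0).
  rewrite axis_fluxE (bigD1 ord0)//= big1 ?addr0 => [|i i0].
    by rewrite mxE !eqxx normr1 mul1r.
  by rewrite mxE (negbTE i0) andbF normr0.
have h i j : i != j -> (e ord0) 0 i * (e ord0) 0 j <= 0.
  rewrite !mxE !eqxx/=; have [->|] := eqVneq i ord0; last by rewrite mul0r.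
  by rewrite eq_sym => /negbTE ->; rewrite mulr0.
move=> /(_ h) E; apply: (mulfI (_ : 2 != 0 :> R)); first by rewrite pnatr_eq0.
by rewrite E; ring.
Qed.

Lemma flux_sum1_homog c w : N (c *: w) = `|c| * N w.
Proof.
rewrite !flux_sum1E mulr_sumr; apply: eq_bigr => I _; rewrite -orthant_flux_homog//;
  congr (J _).
by apply/rowP => i; rewrite !mxE; case: ifP => // _; rewrite mulrN mulrCA.
Qed.

Lemma flux_sum1_triangle (I : Type) (r : seq I) (w : I -> 'rV[R]_n.+1) :
  N (\sum_(k <- r) w k) <= \sum_(k <- r) N (w k).
Proof.
rewrite flux_sum1E; under [leRHS]eq_bigr do rewrite flux_sum1E.
rewrite exchange_big; apply: ler_sum => A _ /=.
rewrite (_ : flip_weight 1 A _ = \sum_(k <- r) flip_weight 1 A (w k));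
  first exact: orthant_flux_triangle.
apply/rowP => i; rewrite summxE mxE summxE; case: ifP => iA.
  rewrite invr1 mul1r -sumrN; apply: eq_bigr => k _.
  by rewrite mxE iA invr1 mul1r.
by apply: eq_bigr => k _; rewrite mxE iA.
Qed.

Lemma flux_sum1_perm (s : 'S_n.+1) w : N (col_perm s w) = N w.
Proof.
rewrite !flux_sum1E [RHS](reindex_inj (finset.imset_inj (@perm_inj _ s))) /=.
apply: eq_bigr => I _; rewrite -[RHS](orthant_flux_perm s _ q1); congr (J _).
apply/rowP => i; rewrite !mxE finset.mem_imset //; exact: perm_inj.
Qed.

Lemma flux_sum1_abs w : N (\row_i `|w 0 i|) = N w.
Proof.
rewrite !flux_sum1E -[RHS](sum_symdiff [set i | w 0 i < 0]%SET).
apply: eq_bigr => I _; congr (J _); apply/rowP => i.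
rewrite !mxE in_symdiff finset.in_set invr1 !mul1r.
case: (i \in I); case: (ltrP (w 0 i) 0) => //= wi;
  by rewrite ?(ltr0_norm wi) ?(ger0_norm wi) ?opprK.
Qed.

(** N is a norm invariant under changes of sign and permutations.  The sum of
    the n + 1 cyclic shifts of (|w_0|, ..., |w_n|) is the constant vector with
    entry |w_0| + ... + |w_n|, and the triangle inequality applies. *)
Lemma flux_sum1_ones w :
  (\sum_i `|w 0 i|) * N (const_mx 1 : 'rV[R]_n.+1) <= n.+1%:R * N w.
Proof.
have L0 : 0 <= \sum_i `|w 0 i| by apply: sumr_ge0.
rewrite -[X in X * _]ger0_norm// -flux_sum1_homog.
pose u : 'rV[R]_n.+1 := \row_i `|w 0 i|.
pose s (k : 'I_n.+1) : 'S_n.+1 := perm (@addrI _ k).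
rewrite (_ : _ *: _ = \sum_k col_perm (s k) u).
  apply: le_trans (flux_sum1_triangle _ _) _.
  under eq_bigr do rewrite flux_sum1_perm flux_sum1_abs.
  by rewrite sumr_const card_ord mulr_natl.
apply/rowP => i; rewrite !mxE mulr1 summxE.
rewrite (reindex_inj (addIr i)); apply: eq_bigr => k _.
by rewrite !mxE permE.
Qed.

End norm.

(** * Volumes of projections *)

Section volumes.
Variables (q : R) (n : nat).
Hypothesis q1 : 1 < q.
Implicit Types (v w : 'rV[R]_n.+1).

Notation e i := (delta_mx 0 i : 'rV[R]_n.+1).
Notation J := (@orthant_flux q n.+1).
Notation N w := (flux_sum q w 1).

Lemma skew_sum1 d (x : 'rV[R]_d) : skew_sum q 1 x = \sum_i `|x 0 i| `^ q.
Proof. by apply: eq_bigr => i _; rewrite skewpow1. Qed.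

Lemma perp_projE v (U : 'M[R]_(n, n.+1)) (A : set 'rV[R]_n.+1) (y : 'rV[R]_n) :
  dotr v v = 1 -> perp_basis v U ->
  (perp_proj v @` A) (y *m U) <-> exists s, A (y *m U + s *: v).
Proof.
move=> v1 [UU Uv0]; rewrite /perp_proj v1.
have yUv : dotr (y *m U) v = 0.
  have := mulmx_dotr (y *m U) v; rewrite -mulmxA Uv0 mulmx0.
  by move=> /matrixP/(_ 0 0); rewrite !mxE eqxx mulr1n.
split=> [[x Ax <-]|[s As]].
  by exists (dotr x v / 1); rewrite subrK.
exists (y *m U + s *: v) => //.
by rewrite dotrDl dotrZl yUv v1 add0r mulr1 divr1 addrK.
Qed.

Lemma projection_vol v : dotr v v = 1 ->
  perp_vol v (perp_proj v @` lq_ball q n.+1) = (q / (2 * layer_mass q n) * N v)%:E.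
Proof.
move=> v1; have Uv := perp_frameP v1.
rewrite -(shadow_volE q1 v1 Uv ltr01) /perp_vol /vol; congr lebesgue_tuple.
apply/seteqP; split => y.
  move=> /(perp_projE _ _ v1 Uv)[s sB]; exists s.
  by rewrite skew_sum1.
move=> [s]; rewrite skew_sum1 => sB; apply/(perp_projE _ _ v1 Uv).
by exists s.
Qed.

Lemma orthant_projection_vol v : dotr v v = 1 ->
  perp_vol v (perp_proj v @` (lq_ball q n.+1 `&` nonneg_orthant n.+1)) =
  (q / (2 * layer_mass q n) * (J v + axis_flux q v))%:E.
Proof.
move=> v1; have Uv := perp_frameP v1.
rewrite -(pos_shadow_vol q1 v1 Uv) /perp_vol /vol; congr lebesgue_tuple.
apply/seteqP; split => y.
  by move=> /(perp_projE _ _ v1 Uv)[s [sB sO]]; exists s.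
by move=> [s [sO sB]]; apply/(perp_projE _ _ v1 Uv); exists s.
Qed.

(** The ball of dimension n is the projection of the ball of dimension n + 1
    along the first axis. *)
Lemma ball_vol : vol (lq_ball q n) = (q / (2 * layer_mass q n) * N (e ord0))%:E.
Proof.
pose U : 'M[R]_(n, n.+1) := rowsub (lift ord0) 1%:M.
have v1 : dotr (e ord0) (e ord0) = 1 by rewrite dotr_delta mxE !eqxx.
have UE i j : U i j = (lift ord0 i == j)%:R by rewrite !mxE.
have yU0 (y : 'rV[R]_n) : (y *m U) 0 ord0 = 0.
  by rewrite mxE big1// => k _; rewrite UE mulr0.
have yUl (y : 'rV[R]_n) k : (y *m U) 0 (lift ord0 k) = y 0 k.
  rewrite mxE (bigD1 k)//= UE eqxx mulr1 big1 ?addr0// => l lk.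
  by rewrite UE (inj_eq (@lift_inj _ ord0)) (negbTE lk) mulr0.
have Uv : perp_basis (e ord0) U.
  split.
    apply/matrixP => i j; rewrite !mxE (bigD1 (lift ord0 i))//= !mxE eqxx mul1r.
    rewrite big1 ?addr0 => [|k ki]; last by rewrite UE eq_sym (negbTE ki) mul0r.
    by rewrite eq_sym (inj_eq (@lift_inj _ ord0)).
  apply/colP => i; rewrite !mxE big_ord_recl big1 ?addr0 => [|k _].
    by rewrite UE mul0r.
  by rewrite !mxE mulr0.
rewrite -(shadow_volE q1 v1 Uv ltr01) /vol; congr lebesgue_tuple.
have S (y : 'rV[R]_n) s : skew_sum q 1 (y *m U + s *: e ord0) =
  `|s| `^ q + \sum_i `|y 0 i| `^ q.
  rewrite skew_sum1 big_ord_recl; congr (_ + _).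
    by rewrite mxE yU0 !mxE !eqxx mulr1 add0r.
  by apply: eq_bigr => i _; rewrite mxE yUl !mxE mulr0 addr0.
apply/seteqP; split => y.
  move=> yB; exists 0; rewrite S normr0 powR0 ?add0r//.
  by rewrite gt_eqF// (lt_trans _ q1).
move=> [s]; rewrite S => h; apply: le_trans h.
by rewrite lerDr powR_ge0.
Qed.

End volumes.

(** * Sign patterns of a unit vector *)

Section signs.
Variables (n : nat) (v : 'rV[R]_n.+1).
Hypothesis v1 : dotr v v = 1.

(** Among three nonzero numbers two have the same sign. *)
Lemma sign_pattern : (forall i j, i != j -> v 0 i * v 0 j <= 0) <->
  #|[pred i | v 0 i != 0]| = 1%N \/
  (#|[pred i | v 0 i != 0]| = 2%N /\ exists i j, v 0 i < 0 /\ 0 < v 0 j).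
Proof.
pose S := [set i | v 0 i != 0]%SET.
have SE : #|[pred i | v 0 i != 0]| = #|S| by rewrite finset.cardsE.
have Sn0 : S != finset.set0.
  have /rV0Pn[i vi] := direction_neq0 v1.
  by apply/finset.set0Pn; exists i; rewrite finset.in_set.
rewrite SE; split=> [h|].
  have [i iS] := finset.set0Pn _ Sn0.
  have [j /andP[ji jS]|hS] := pickP (fun j => (j != i) && (j \in S)); last first.
    left; apply/eqP/finset.cards1P; exists i; apply/setP => k.
    rewrite finset.in_set1; have [->//|ki] := eqVneq k i.
    by have := hS k; rewrite ki.
  move: (iS) (jS); rewrite !finset.in_set => vi vj.
  have opp k l : k != l -> v 0 k != 0 -> 0 < v 0 l -> v 0 k < 0.
    move=> kl vk vl; have := h _ _ kl; rewrite pmulr_lle0// => vk'.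
    by rewrite lt_neqAle vk.
  have opp' k l : k != l -> v 0 k != 0 -> v 0 l < 0 -> 0 < v 0 k.
    move=> kl vk vl; have := h _ _ kl; rewrite nmulr_lle0// => vk'.
    by rewrite lt_neqAle eq_sym vk.
  have third k : k != i -> k != j -> v 0 k = 0.
    move=> ki kj; apply/eqP; apply: contraT => vk.
    have ij : i != j by rewrite eq_sym.
    have [vi0|vi0|vi0] := ltgtP (v 0 i) 0; last by rewrite vi0 eqxx in vi.
      have := opp _ _ ki vk; have := opp' _ _ ki vk vi0; have :=
        opp' _ _ ji vj vi0 => a b _.
      by have := opp _ _ kj vk a; rewrite ltNge ltW.
    have a := opp _ _ ki vk vi0; have b := opp _ _ ji vj vi0.
    by have := opp' _ _ kj vk b; rewrite ltNge ltW.
  right; split.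
    have -> : S = [set i; j]%SET.
      apply/setP => k; rewrite finset.in_set finset.in_set2.
      have [->|ki] := eqVneq k i; first by rewrite vi.
      have [->|kj] := eqVneq k j; first by rewrite vj.
      by rewrite third// eqxx.
    by rewrite finset.cards2 eq_sym ji.
  have [vi0|vi0|vi0] := ltgtP (v 0 i) 0; last by rewrite vi0 eqxx in vi.
    by exists i, j; split => //; exact: opp' vi0.
  by exists j, i; split => //; exact: opp vi0.
move=> + k l kl.
have [->|vk] := eqVneq (v 0 k) 0; first by rewrite mul0r.
have [->|vl] := eqVneq (v 0 l) 0; first by rewrite mulr0.
have kS : k \in S by rewrite finset.in_set.
have lS : l \in S by rewrite finset.in_set.
case=> [/eqP/finset.cards1P[i Si]|[c2 [i [j [vi vj]]]]].
  by move: kS lS kl; rewrite Si !finset.in_set1 => /eqP -> /eqP ->; rewrite eqxx.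
have ij : i != j by apply: contraTneq vi => ->; rewrite -leNgt ltW.
have Sij : S = [set i; j]%SET.
  apply/esym/eqP; rewrite finset.eqEcard c2 finset.cards2 ij leqnn andbT.
  apply/fintype.subsetP => m; rewrite finset.in_set2 finset.in_set => /orP[] /eqP ->;
    by rewrite ?(lt_eqF vi) ?(gt_eqF vj).
have ve : v 0 i * v 0 j < 0 by rewrite nmulr_rlt0.
move: kS lS kl; rewrite Sij !finset.in_set2 => /orP[] /eqP -> /orP[] /eqP ->;
  rewrite ?eqxx// => _.
  exact: ltW.
by rewrite mulrC ltW.
Qed.

End signs.

End projections.

Theorem proposition24 (R : realType) (n : nat) (hn : (1 <= n)%N)
    (q : R) (hq : 1 < q) :
  (forall v : 'rV[R]_n.+1, dotr v v = 1 ->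
    let full := perp_vol v (perp_proj v @` lq_ball q n.+1) in
    let part :=
      perp_vol v (perp_proj v @` (lq_ball q n.+1 `&` nonneg_orthant n.+1)) in
    [/\ ((c_const q n)%:E * part <= full)%E,
        (full <= (2 ^+ n)%R%:E * part)%E
      & full = ((2 ^+ n)%R%:E * part)%E <->
          #|[pred i | v 0 i != 0]| = 1%N \/
          (#|[pred i | v 0 i != 0]| = 2%N /\
           exists i j, v 0 i < 0 /\ 0 < v 0 j)]) /\
  ((c_const q n)%:E *
     perp_vol (theta_vec n)
       (perp_proj (theta_vec n) @` (lq_ball q n.+1 `&` nonneg_orthant n.+1)))%E =
  perp_vol (theta_vec n) (perp_proj (theta_vec n) @` lq_ball q n.+1).
Proof.
pose s : R := Num.sqrt n.+1%:R.
have s0 : 0 < s by rewrite sqrtr_gt0.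
have ss : s * s = n.+1%:R by rewrite -expr2 sqr_sqrtr.
have thetaE : theta_vec n = s^-1 *: (const_mx 1 : 'rV[R]_n.+1).
  by apply/rowP => i; rewrite !mxE mulr1.
have theta1 : dotr (theta_vec n : 'rV[R]_n.+1) (theta_vec n) = 1.
  rewrite /dotr; under eq_bigr do rewrite mxE.
  rewrite sumr_const card_ord -[LHS]mulr_natl -/s -ss; field; exact: lt0r_neq0.
pose C := q / (2 * layer_mass q n).
have C0 : 0 < C by rewrite divr_gt0 ?mulr_gt0 ?layer_mass_gt0// (lt_trans _ hq).
pose j := @orthant_flux R q n.+1 (delta_mx 0 ord0).
have j0 : 0 < j by exact: orthant_flux_delta_gt0.
pose N1 := flux_sum q (const_mx 1 : 'rV[R]_n.+1) 1.
(* The volume of the n-ball is C 2^(n+1) j by projection along an axis. *)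
have cE : c_const q n = N1 / (2 * n.+1%:R * j).
  rewrite /c_const (projection_vol hq theta1) ball_vol// flux_sum1_delta// -/C -/j /=
    thetaE flux_sum1_homog// -/N1.
  rewrite ger0_norm ?invr_ge0 ?(ltW s0)// -/s -ss exprS.
  field; rewrite !lt0r_neq0 ?exprn_gt0//.
split=> [v v1 full part|]; last first.
  rewrite orthant_projection_vol// projection_vol// -/C cE -EFinM; congr EFin.
  have th0 i : 0 <= (theta_vec n : 'rV[R]_n.+1) 0 i by rewrite mxE invr_ge0 ltW.
  have -> : @orthant_flux R q n.+1 (theta_vec n) =
    axis_flux q (theta_vec n : 'rV[R]_n.+1).
    by rewrite orthant_flux_ge0_weight//; apply: eq_bigr => i _; rewrite ger0_norm.
  have -> : axis_flux q (theta_vec n : 'rV[R]_n.+1) = s * j.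
    rewrite axis_fluxE// -/j; congr (_ * _).
    under eq_bigr do rewrite ger0_norm// mxE.
    rewrite sumr_const card_ord -[LHS]mulr_natl -/s -ss; field; exact: lt0r_neq0.
  rewrite thetaE flux_sum1_homog// ger0_norm ?invr_ge0 ?(ltW s0)// -/N1 -ss.
  by field; rewrite !lt0r_neq0.
pose L := \sum_i `|v 0 i|.
have oneE : axis_flux q v = L * j by rewrite axis_fluxE.
have fullE : full = (C * flux_sum q v 1)%:E by rewrite /full projection_vol.
have partE : part = (C * (@orthant_flux R q n.+1 v + axis_flux q v))%:E.
  by rewrite /part orthant_projection_vol.
rewrite fullE partE -!EFinM !lee_fin; split.
(* J v <= L j bounds the orthant projection by 2 L j C, and N v is at least
   L N1 / (n + 1). *)
- rewrite mulrCA ler_pM2l// cE oneE.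
  have JL : @orthant_flux R q n.+1 v <= L * j by rewrite -oneE; exact: orthant_flux_ub.
  have N10 : 0 <= N1 by apply: sumr_ge0 => I _;
    rewrite mulr_ge0 ?orthant_flux_ge0 ?exprn_ge0.
  have LN := flux_sum1_ones hq v; rewrite -/L -/N1 in LN.
  apply: (@le_trans _ _ (N1 / (2 * n.+1%:R * j) * (2 * L * j))).
    rewrite ler_wpM2l ?divr_ge0 ?mulr_ge0 ?(ltW j0)//; lra.
  rewrite [leLHS](_ : _ = L * N1 / n.+1%:R); last first.
    by rewrite -ss; field; rewrite !lt0r_neq0.
  by rewrite ler_pdivrMr// [leRHS]mulrC.
- rewrite mulrCA ler_pM2l// -(ler_pM2l (ltr0n R 2)) mulrA -exprS.
  exact: flux_sum1_le.
- rewrite -sign_pattern//.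
  have -> : ((C * flux_sum q v 1)%:E =
      (2 ^+ n * (C * (@orthant_flux R q n.+1 v + axis_flux q v)))%:E) <->
      2 * flux_sum q v 1 = 2 ^+ n.+1 * (@orthant_flux R q n.+1 v + axis_flux q v).
    split=> [[]|E].
      by rewrite mulrCA => /(mulfI (lt0r_neq0 C0)) ->; rewrite exprS mulrA.
    congr EFin; rewrite mulrCA; congr (_ * _).
    apply: (mulfI (_ : 2 != 0 :> R)); first by rewrite pnatr_eq0.
    by rewrite E exprS mulrA.
  split=> [E i k ik|]; last exact: flux_sum1_eq.
  rewrite leNgt; apply/negP => vik.
  by have := flux_sum1_lt hq ik vik; rewrite E ltxx.
Qed.
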